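(* Consider the system of partial differential equations $$\partial_s \boldsymbol{\omega} - \partial_t \boldsymbol{\kappa} + \boldsymbol{\omega}\times\boldsymbol{\kappa} = \boldsymbol{0} \qquad (\ast)$$ for two vector-functions $\boldsymbol{\omega}(s,t),\boldsymbol{\kappa}(s,t)\in\mathbb{R}^3$ of the independent real variables $(s,t)$. For an analytic vector-function $\boldsymbol{p}(s,t)=(a(s,t),b(s,t),c(s,t))\in\mathbb{R}^3$ and an analytic vector-function $\boldsymbol{f}(t)=(f_1(t),f_2(t),f_3(t))\in\mathbb{R}^3$, put $p:=|\boldsymbol{p}|=\sqrt{a^2+b^2+c^2}$ and define $$\begin{aligned} \boldsymbol{\omega} =\;& \boldsymbol{f}(t) + \frac{\sin p}{p}\,\boldsymbol{p}\times \boldsymbol{f}(t) + \frac{1-\cos p}{p^2}\left(\boldsymbol{p}\,(\boldsymbol{p}\cdot \boldsymbol{f}(t))-p^2\,\boldsymbol{f}(t)\right)+\partial_t \boldsymbol{p}\\ &+\frac{p-\sin p}{p^3}\left(\boldsymbol{p}\,(\boldsymbol{p}\cdot\partial_t \boldsymbol{p})-p^2\,\partial_t \boldsymbol{p}\right)+\frac{1-\cos p}{p^2}\,\boldsymbol{p}\times \partial_t \boldsymbol{p},\\ \boldsymbol{\kappa} =\;& \partial_s \boldsymbol{p}+\frac{p-\sin p}{p^3}\left(\boldsymbol{p}\,(\boldsymbol{p}\cdot\partial_s \boldsymbol{p})-p^2\,\partial_s \boldsymbol{p}\right)+\frac{1-\cos p}{p^2}\,\boldsymbol{p}\times \partial_s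 \boldsymbol{p}. \end{aligned}\qquad (\ast\ast)$$ Then: 1. (Solution.) For every open set $D\subseteq\mathbb{R}^2$, every open set $I\subseteq\mathbb{R}$ with $D\subseteq\mathbb{R}\times I$, and all analytic $\boldsymbol{p}:D\to\mathbb{R}^3$ and $\boldsymbol{f}:I\to\mathbb{R}^3$, the pair $(\boldsymbol{\omega},\boldsymbol{\kappa})$ given by $(\ast\ast)$ is a solution of $(\ast)$ on $D$. 2. (Generality.) The solution $(\ast\ast)$ is general, in the sense that every analytic solution is locally of this form: for every analytic solution $(\boldsymbol{\omega},\boldsymbol{\kappa})$ of $(\ast)$ on a neighborhood of a point $(s_0,t_0)\in\mathbb{R}^2$, there exist an analytic $\boldsymbol{p}$ defined on a neighborhood of $(s_0,t_0)$ and an analytic $\boldsymbol{f}$ defined on a neighborhood of $t_0$ such that $(\ast\ast)$ holds on some neighborhood of $(s_0,t_0)$.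
   Context: Here $\times$ and $\cdot$ denote the standard cross product and dot product on $\mathbb{R}^3$, and ''analytic'' means real analytic. The coefficients $\frac{\sin p}{p}$, $\frac{1-\cos p}{p^2}$, $\frac{p-\sin p}{p^3}$ are even power series in $p$, hence everywhere convergent power series in $p^2=a^2+b^2+c^2$; at points where $p=0$ they take their limit values $1$, $\tfrac12$, $\tfrac16$. Equivalently, let $\hat{\boldsymbol{A}}$ be the skew-symmetric matrix $$\hat{\boldsymbol{A}}=\begin{bmatrix} 0 & -c & b\\ c & 0 & -a\\ -b & a & 0\end{bmatrix},$$ so that $\hat{\boldsymbol{A}}\boldsymbol{v}=\boldsymbol{p}\times\boldsymbol{v}$ for $\boldsymbol{v}\in\mathbb{R}^3$. Then the formulae $(\ast\ast)$ read $$\boldsymbol{\omega}=\exp(\hat{\boldsymbol{A}})\boldsymbol{f}+\Big(\exp(\hat{\boldsymbol{A}})\int_0^1\exp(-y\hat{\boldsymbol{A}})\,dy\Big)\partial_t\boldsymbol{p},\qquad \boldsymbol{\kappa}=\Big(\exp(\hat{\boldsymbol{A}})\int_0^1\exp(-y\hat{\boldsymbol{A}})\,dy\Big)\partial_s\boldsymbol{p}.$$ *)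

(* Defs.v *)
From Stdlib Require Import Reals.
From Coquelicot Require Import Coquelicot.
Open Scope R_scope.

(* A product of copies of [R], so that [plus], [minus], [scal], [zero],
   [is_series], [ex_derive], ... are those of the product normed module. *)
Notation R3 := (R * R * R)%type.

Definition vec_x (v : R3) : R := fst (fst v).
Definition vec_y (v : R3) : R := snd (fst v).
Definition vec_z (v : R3) : R := snd v.

Definition dot (u v : R3) : R := vec_x u * vec_x v + vec_y u * vec_y v + vec_z u * vec_z v.

Definition cross (u v : R3) : R3 :=
  (vec_y u * vec_z v - vec_z u * vec_y v,
   vec_z u * vec_x v - vec_x u * vec_z v,
   vec_x u * vec_y v - vec_y u * vec_x v).

(* The Euclidean norm; Coquelicot's [norm] on [R3] is only equivalent to it. *)
Definition enorm (v : R3) : R := sqrt (dot v v).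

(* Like [Derive], total: only meaningful where the components are derivable. *)
Definition Derive3 (f : R -> R3) (x : R) : R3 :=
  (Derive (fun u => vec_x (f u)) x,
   Derive (fun u => vec_y (f u)) x,
   Derive (fun u => vec_z (f u)) x).

Definition d_s (w : R -> R -> R3) (s t : R) : R3 := Derive3 (fun s' => w s' t) s.
Definition d_t (w : R -> R -> R3) (s t : R) : R3 := Derive3 (fun t' => w s t') t.

(* Absolute convergence is automatic on the open interval. *)
Definition analytic1_at {V : NormedModule R_AbsRing} (f : R -> V) (x0 : R) : Prop :=
  exists (a : nat -> V) (r : R), 0 < r /\
    forall x : R, Rabs (x - x0) < r -> is_pseries a (x - x0) (f x).

(* A double power series has no canonical order of summation, so it is required
   to converge absolutely; it is summed here by homogeneous degree [n]. *)
Definition analytic2_at {V : NormedModule R_AbsRing}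
    (f : R -> R -> V) (x0 y0 : R) : Prop :=
  exists (a : nat -> nat -> V) (r : R), 0 < r /\
    forall x y : R, Rabs (x - x0) < r -> Rabs (y - y0) < r ->
      let term (j k : nat) : V := scal ((x - x0) ^ j * (y - y0) ^ k) (a j k) in
      ex_series (fun n => sum_n (fun k => norm (term k (n - k)%nat)) n) /\
      is_series (fun n => sum_n (fun k => term k (n - k)%nat) n) (f x y).

(* A function on an open set is represented by a total function whose values
   outside of that set are irrelevant. *)
Definition analytic1_on {V : NormedModule R_AbsRing}
    (I : R -> Prop) (f : R -> V) : Prop :=
  forall x : R, I x -> analytic1_at f x.

Definition analytic2_on {V : NormedModule R_AbsRing}
    (D : R * R -> Prop) (f : R -> R -> V) : Prop :=
  forall x y : R, D (x, y) -> analytic2_at f x y.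

Definition is_solution (D : R * R -> Prop) (omega kappa : R -> R -> R3) : Prop :=
  forall s t : R, D (s, t) ->
    ex_derive (fun s' => omega s' t) s /\
    ex_derive (fun t' => kappa s t') t /\
    plus (minus (d_s omega s t) (d_t kappa s t)) (cross (omega s t) (kappa s t))
      = zero.

Definition coef_sin (p : R) : R :=
  if Req_EM_T p 0 then 1 else sin p / p.
Definition coef_cos (p : R) : R :=
  if Req_EM_T p 0 then 1 / 2 else (1 - cos p) / p ^ 2.
Definition coef_sub_sin (p : R) : R :=
  if Req_EM_T p 0 then 1 / 6 else (p - sin p) / p ^ 3.

Declare Scope vec3_scope.
Delimit Scope vec3_scope with vec3.
Notation "u + v" := (plus (u : R3) (v : R3)) : vec3_scope.
Notation "u - v" := (minus (u : R3) (v : R3)) : vec3_scope.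
Notation "x *: v" := (scal (x%R : R) (v : R3))
  (at level 40, left associativity) : vec3_scope.

Definition omega_of (p : R -> R -> R3) (f : R -> R3) (s t : R) : R3 :=
  let P := p s t in
  let n := enorm P in
  let F := f t in
  let Pt := d_t p s t in
  (F + coef_sin n *: cross P F
     + coef_cos n *: (dot P F *: P - n ^ 2 *: F)
     + Pt
     + coef_sub_sin n *: (dot P Pt *: P - n ^ 2 *: Pt)
     + coef_cos n *: cross P Pt)%vec3.

Definition kappa_of (p : R -> R -> R3) (s t : R) : R3 :=
  let P := p s t in
  let n := enorm P in
  let Ps := d_s p s t in
  (Ps + coef_sub_sin n *: (dot P Ps *: P - n ^ 2 *: Ps)
      + coef_cos n *: cross P Ps)%vec3.

(* Main.v *)
(** For [R] the exponential of the skew matrix of [p], [kappa_of p] is the axial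
    vector of [d_s R R^-1], and [omega_of p f] that of [d_t R R^-1] plus [R f]: the
    flat connection [(f, 0)] in another gauge.  Concretely, once the coefficients
    are written as entire functions of [q = |p|^2], the curvature equation is a
    polynomial identity modulo their differential equations and
    [sin^2 + cos^2 = 1].

    Conversely, given an analytic solution, [kappa = kappa_of p] amounts to an
    ordinary differential equation [d_s p = lift3 g p kappa] in [s] with parameter
    [t], where [g] is an analytic function of [q].  Adjoining [g] and
    [m = 1 / q] as unknowns makes it polynomial, so it has an analytic solution by
    comparison of coefficients.  The initial value [p (s0, t) = (PI, 0, 0)] keeps
    [q] away from [0], where the equation of [m] is singular.  At [s = s0] the
    equation [omega = omega_of p f] then determines [f], and it propagates in [s]
    because both sides solve [d_s W = d_t kappa - W x kappa]. *)

Require Import Defs.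
From Stdlib Require Import Reals Factorial Lra Lia FunctionalExtensionality.
From Coquelicot Require Import Coquelicot.
Open Scope R_scope.

(** The obstacle is joint analyticity of [p] in [(s, t)], with convergence under control. All
    coefficients are bounded by [M * r ^ (j + k)], where [r] is an inverse radius that an operation
    may enlarge. Making the equation polynomial means that no composite power series is ever
    expanded: sums and Cauchy products suffice. With [A] the skew matrix of [p], [kappa_of] applies
    [(exp A - 1) / A] to [d_s p]. Since [A^3 = - q A], the inverse [A / (exp A - 1)] is
    [1 - A / 2 + g A^2] with [g = (1 - (|p|/2) cot (|p|/2)) / q], and this [g] solves the Riccati
    equation [2 dg/dq = m / 4 - 3 g m + g^2]. The adjoined unknowns are at first mere solutions of
    their equations. That they have the intended meaning is expressed by two relations, [m q = 1]
    and the vanishing of a residue for [g]; each defect satisfies a linear homogeneous equation in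
    [s], hence stays zero. The length [PI] lies midway between [0] and [2 PI], where
    [(exp A - 1) / A] becomes singular. As the initial value is constant in [t], [d_t p] vanishes on
    [s = s0], and there [omega_of p f] is just a half turn of [f]. *)

(** * Double power series *)

(* [ring] needs the carrier of Coquelicot's structures in the form [R]. *)
Ltac change_R := match goal with |- @eq _ ?a ?b => change (@eq R a b) end.

(** Here [r] is the inverse of a radius: shrinking the domain means enlarging [r]. Most evaluations
    below take place where [|x| * r <= / 2], which yields constants such as [2 * M] and [4 * M]. *)
Definition geo1 (M r : R) (a : nat -> R) : Prop :=
  forall k, Rabs (a k) <= M * r ^ k.

Definition geo2 (M r : R) (a : nat -> nat -> R) : Prop :=
  forall j k, Rabs (a j k) <= M * r ^ (j + k).

(** Summation by rows makes the one-variable theory of [PSeries] applicable; [is_series_diag]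
    compares it with the sum by homogeneous degree of [analytic2_at]. *)
Definition PS2 (a : nat -> nat -> R) (x y : R) : R :=
  PSeries (fun j => PSeries (a j) y) x.

Lemma geo1_nonneg (M r : R) (a : nat -> R) : geo1 M r a -> 0 <= M.
Proof.
intros H. generalize (H 0%nat) (Rabs_pos (a 0%nat)). simpl. lra.
Qed.

Lemma geo2_nonneg (M r : R) (a : nat -> nat -> R) : geo2 M r a -> 0 <= M.
Proof.
intros H. generalize (H 0%nat 0%nat) (Rabs_pos (a 0%nat 0%nat)). simpl. lra.
Qed.

Lemma geo1_CV_radius (M r : R) (a : nat -> R) (x : R) :
  0 < r -> geo1 M r a -> Rabs x * r < 1 -> Rbar_lt (Rabs x) (CV_radius a).
Proof.
intros Hr Ha Hx.
apply Rbar_lt_le_trans with (Finite (/ r)).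
- simpl. apply Rmult_lt_reg_r with r; trivial.
  rewrite Rinv_l; lra.
- apply (CV_radius_bounded a). exists M. intros n.
  rewrite Rabs_mult.
  assert (Hn : 0 < r ^ n) by now apply pow_lt.
  rewrite pow_inv, (Rabs_right (/ r ^ n)).
  2: apply Rle_ge, Rlt_le, Rinv_0_lt_compat, Hn.
  apply Rmult_le_reg_r with (r ^ n); trivial.
  rewrite Rmult_assoc, Rinv_l, Rmult_1_r by lra.
  apply Ha.
Qed.

Lemma geo1_term (M r : R) (a : nat -> R) (x : R) (n : nat) :
  geo1 M r a -> Rabs (a n * x ^ n) <= M * (Rabs x * r) ^ n.
Proof.
intros Ha.
rewrite Rabs_mult, <- RPow_abs, Rpow_mult_distr.
rewrite (Rmult_comm (Rabs x ^ n)), <- Rmult_assoc.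
apply Rmult_le_compat_r; [apply pow_le, Rabs_pos | apply Ha].
Qed.

Lemma ex_series_geom_scal (M q : R) :
  0 <= q < 1 -> ex_series (fun n => M * q ^ n).
Proof.
intros Hq. exists (M * / (1 - q)).
apply (is_series_scal M (fun n => q ^ n)).
apply is_series_geom. rewrite Rabs_right; lra.
Qed.

Lemma Series_geom_scal (M q : R) :
  0 <= q < 1 -> Series (fun n => M * q ^ n) = M / (1 - q).
Proof.
intros Hq.
rewrite Series_scal_l, Series_geom; trivial. rewrite Rabs_right; lra.
Qed.

Lemma geo1_ex_series_Rabs (M r : R) (a : nat -> R) (x : R) :
  0 < r -> geo1 M r a -> Rabs x * r < 1 ->
  ex_series (fun n => Rabs (a n * x ^ n)).
Proof. intros Hr Ha Hx. apply CV_disk_inside, (geo1_CV_radius M r); trivial. Qed.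

Lemma geo1_ex_pseries (M r : R) (a : nat -> R) (x : R) :
  0 < r -> geo1 M r a -> Rabs x * r < 1 -> ex_pseries a x.
Proof.
intros Hr Ha Hx. apply CV_radius_inside, (geo1_CV_radius M r); trivial.
Qed.

Lemma PSeries_geo1 (M r : R) (a : nat -> R) (x : R) :
  0 < r -> geo1 M r a -> Rabs x * r <= / 2 -> Rabs (PSeries a x) <= 2 * M.
Proof.
intros Hr Ha Hx.
assert (H0 : 0 <= Rabs x * r) by (apply Rmult_le_pos; [apply Rabs_pos|lra]).
assert (HM := geo1_nonneg _ _ _ Ha).
unfold PSeries.
apply Rle_trans with (Series (fun n => Rabs (a n * x ^ n))).
- apply Series_Rabs, (geo1_ex_series_Rabs M r); trivial. lra.
- apply Rle_trans with (Series (fun n => M * (Rabs x * r) ^ n)).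
  + apply Series_le. 2: apply ex_series_geom_scal; lra.
    intros n. split; [apply Rabs_pos|]. now apply geo1_term.
  + rewrite Series_geom_scal by lra.
    unfold Rdiv. rewrite (Rmult_comm 2).
    apply Rmult_le_compat_l; trivial.
    rewrite <- (Rinv_inv 2).
    apply Rinv_le_contravar; lra.
Qed.

Lemma geo2_row (M r : R) (a : nat -> nat -> R) (j : nat) :
  geo2 M r a -> geo1 (M * r ^ j) r (a j).
Proof. intros Ha k. rewrite Rmult_assoc, <- pow_add. apply Ha. Qed.

Lemma geo2_geo1 (M r : R) (a : nat -> nat -> R) (y : R) :
  0 < r -> geo2 M r a -> Rabs y * r <= / 2 ->
  geo1 (2 * M) r (fun j => PSeries (a j) y).
Proof.
intros Hr Ha Hy j. rewrite Rmult_assoc.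
apply PSeries_geo1 with r; trivial. now apply geo2_row.
Qed.

Lemma PS2_geo2 (M r : R) (a : nat -> nat -> R) (x y : R) :
  0 < r -> geo2 M r a -> Rabs x * r <= / 2 -> Rabs y * r <= / 2 ->
  Rabs (PS2 a x y) <= 4 * M.
Proof.
intros Hr Ha Hx Hy. replace (4 * M) with (2 * (2 * M)) by ring.
apply PSeries_geo1 with r; trivial. now apply geo2_geo1.
Qed.

Lemma geo2_weaken (M M' r r' : R) (a : nat -> nat -> R) :
  0 <= r -> M <= M' -> r <= r' -> geo2 M r a -> geo2 M' r' a.
Proof.
intros Hr HM Hr' Ha j k.
assert (H0 := geo2_nonneg _ _ _ Ha).
apply Rle_trans with (1 := Ha j k).
apply Rmult_le_compat; trivial.
- now apply pow_le.
- now apply pow_incr.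
Qed.

Lemma sum_n_triangle (b : nat -> nat -> R) (N : nat) :
  sum_n (fun n => sum_n (fun k => b k (n - k)%nat) n) N =
  sum_n (fun j => sum_n (b j) (N - j)) N.
Proof.
induction N as [|N IH].
- now rewrite !sum_O.
- rewrite sum_Sn, IH, !sum_Sn.
  rewrite (sum_n_ext_loc (fun j => sum_n (b j) (S N - j))
    (fun j => plus (sum_n (b j) (N - j)) (b j (S N - j)%nat))).
  2: { intros n Hn. replace (S N - n)%nat with (S (N - n)) by lia.
       now rewrite sum_Sn. }
  rewrite sum_n_plus.
  replace (S N - S N)%nat with 0%nat by lia. rewrite sum_O.
  now rewrite plus_assoc.
Qed.

Lemma Series_tail_geom (b : nat -> R) (M q : R) (N : nat) :
  0 <= q < 1 -> (forall k, Rabs (b k) <= M * q ^ k) ->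
  Rabs (Series b - sum_n b N) <= M * q ^ (S N) / (1 - q).
Proof.
intros Hq Hb.
assert (Hex : ex_series b).
{ apply (@ex_series_le R_AbsRing R_CompleteNormedModule b (fun n => M * q ^ n)).
  - exact Hb.
  - now apply ex_series_geom_scal. }
rewrite (Series_incr_n b (S N)) by (trivial; lia).
simpl pred. rewrite sum_n_Reals.
replace (_ + _ - _) with (Series (fun k => b (S N + k)%nat)) by ring.
assert (Hle : forall n, Rabs (b (S N + n)%nat) <= M * q ^ S N * q ^ n).
{ intros n. rewrite Rmult_assoc, <- pow_add. apply Hb. }
apply Rle_trans with (Series (fun k => Rabs (b (S N + k)%nat))).
- apply Series_Rabs.
  apply (@ex_series_le R_AbsRing R_CompleteNormedModule _ (fun n => M * q ^ S N * q ^ n)).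
  + intros n. unfold norm; simpl; unfold abs; simpl. rewrite Rabs_Rabsolu. apply Hle.
  + now apply ex_series_geom_scal.
- rewrite <- Series_geom_scal by trivial.
  apply Series_le. 2: now apply ex_series_geom_scal.
  intros n. split; [apply Rabs_pos|]. apply Hle.
Qed.

Lemma is_lim_seq_INR_mult_pow (q : R) :
  0 <= q < 1 -> is_lim_seq (fun n => INR (S n) * q ^ n) 0.
Proof.
intros Hq.
(* The ratio test used below requires nonzero terms, so [q = 0] is treated apart. *)
destruct (Req_dec q 0) as [->|Hq0].
- apply is_lim_seq_ext_loc with (fun _ => 0). 2: apply is_lim_seq_const.
  exists 1%nat. intros n Hn. destruct n; [lia|]. simpl. ring.
- apply ex_series_lim_0.
  apply ex_series_Rabs, ex_series_DAlembert with q; [lra| |].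
  + intros n. apply Rmult_integral_contrapositive. split.
    * apply not_0_INR. lia.
    * now apply pow_nonzero.
  + apply is_lim_seq_ext with (fun n => (1 + / INR (S n)) * q).
    * intros n. rewrite Rabs_right.
      -- rewrite (S_INR (S n)). simpl pow. field.
         split; [now apply pow_nonzero|]. apply not_0_INR. lia.
      -- apply Rle_ge, Rmult_le_pos.
         ++ apply Rmult_le_pos; [apply pos_INR|]. apply pow_le; lra.
         ++ apply Rlt_le, Rinv_0_lt_compat, Rmult_lt_0_compat.
            apply lt_0_INR; lia. apply pow_lt; lra.
    * replace (Finite q) with (Finite ((1 + 0) * q)) by (f_equal; ring).
      apply is_lim_seq_mult'; [|apply is_lim_seq_const].
      apply is_lim_seq_plus'; [apply is_lim_seq_const|].
      apply (is_lim_seq_incr_1 (fun n => / INR n)).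
      replace (Finite 0) with (Rbar_inv p_infty) by reflexivity.
      apply is_lim_seq_inv; [apply is_lim_seq_INR | easy].
Qed.

Lemma Rabs_sum_n_le (u v : nat -> R) (N : nat) :
  (forall j, (j <= N)%nat -> Rabs (u j) <= v j) ->
  Rabs (sum_n u N) <= sum_n v N.
Proof.
induction N as [|N IH]; intros H.
- rewrite !sum_O. apply H. lia.
- rewrite !sum_Sn. apply Rle_trans with (1 := Rabs_triang _ _).
  apply Rplus_le_compat; auto.
Qed.

(** The triangle [j + k <= N] misses the tails of the rows up to [N], each at most
    [M * q ^ (N + 1) / (1 - q)], and all later rows, a geometric tail. The total is of order
    [(N + 1) * q ^ N]. *)
Lemma is_series_diag (b : nat -> nat -> R) (M q : R) :
  0 <= q < 1 -> (forall j k, Rabs (b j k) <= M * q ^ (j + k)) ->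
  is_series (fun n => sum_n (fun k => b k (n - k)%nat) n)
    (Series (fun j => Series (b j))).
Proof.
intros Hq Hb.
set (S0 := Series _).
assert (HM : 0 <= M).
{ generalize (Hb 0%nat 0%nat) (Rabs_pos (b 0%nat 0%nat)). simpl. lra. }
assert (Hi : 0 < / (1 - q)) by (apply Rinv_0_lt_compat; lra).
assert (Hrow : forall j N, Rabs (Series (b j) - sum_n (b j) N)
           <= M * q ^ (j + S N) / (1 - q)).
{ intros j N. rewrite pow_add, <- Rmult_assoc. apply Series_tail_geom; trivial.
  intros k. rewrite Rmult_assoc, <- pow_add. apply Hb. }
assert (Hcol : forall j, Rabs (Series (b j)) <= M / (1 - q) * q ^ j).
{ intros j. apply Rle_trans with (Series (fun k => M * q ^ j * q ^ k)).
  - apply Rle_trans with (Series (fun k => Rabs (b j k))).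
    + apply Series_Rabs.
      apply (@ex_series_le R_AbsRing R_CompleteNormedModule _ (fun n => M * q ^ j * q ^ n)).
      * intros n. unfold norm; simpl; unfold abs; simpl. rewrite Rabs_Rabsolu.
        rewrite Rmult_assoc, <- pow_add. apply Hb.
      * now apply ex_series_geom_scal.
    + apply Series_le. 2: now apply ex_series_geom_scal.
      intros n. split; [apply Rabs_pos|].
      rewrite Rmult_assoc, <- pow_add. apply Hb.
  - rewrite Series_geom_scal by trivial. apply Req_le. field. lra. }
set (C := M / (1 - q) + M / (1 - q) / (1 - q)).
assert (Hlim : is_lim_seq (fun N => C * (INR (S N) * q ^ N)) 0).
{ replace (Finite 0) with (Rbar_mult C 0) by (simpl; f_equal; ring).
  now apply is_lim_seq_scal_l, is_lim_seq_INR_mult_pow. }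
change (is_lim_seq (sum_n (fun n => sum_n (fun k => b k (n - k)%nat) n)) S0).
assert (Hd : is_lim_seq (fun N =>
   sum_n (fun n => sum_n (fun k => b k (n - k)%nat) n) N - S0) 0).
{ apply is_lim_seq_abs_0.
  apply is_lim_seq_le_le with (fun _ => 0) (fun N => C * (INR (S N) * q ^ N));
    trivial; [|apply is_lim_seq_const].
  intros N. split; [apply Rabs_pos|].
  rewrite sum_n_triangle.
  set (A := sum_n _ N).
  replace (A - S0) with
    ((A - sum_n (fun j => Series (b j)) N)
      - (S0 - sum_n (fun j => Series (b j)) N)) by ring.
  apply Rle_trans with (1 := Rabs_triang _ _). rewrite Rabs_Ropp.
  assert (HqN : 0 <= q ^ N) by (apply pow_le; lra).
  assert (H1 : Rabs (A - sum_n (fun j => Series (b j)) N)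
           <= M / (1 - q) * (INR (S N) * q ^ N)).
  { unfold A. replace (sum_n _ N - _) with
      (sum_n (fun j => sum_n (b j) (N - j) - Series (b j)) N).
    2: { rewrite !sum_n_Reals. apply minus_sum. }
    replace (M / (1 - q) * (INR (S N) * q ^ N)) with
      (sum_n (fun _ => M / (1 - q) * q ^ N) N)
      by (rewrite sum_n_const; change_R; ring).
    apply Rabs_sum_n_le. intros j Hj.
    rewrite Rabs_minus_sym.
    apply Rle_trans with (1 := Hrow j (N - j)%nat).
    replace (j + S (N - j))%nat with (S N) by lia.
    simpl pow. unfold Rdiv. rewrite !Rmult_assoc.
    apply Rmult_le_compat_l; trivial.
    assert (H : 0 <= q ^ N * / (1 - q)) by (apply Rmult_le_pos; lra).
    nra. }
  assert (H2 : Rabs (S0 - sum_n (fun j => Series (b j)) N)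
           <= M / (1 - q) / (1 - q) * (INR (S N) * q ^ N)).
  { unfold S0. apply Rle_trans with (1 := Series_tail_geom _ _ _ N Hq Hcol).
    unfold Rdiv. simpl pow.
    replace (M * / (1 - q) * (q * q ^ N) * / (1 - q)) with
      (M * / (1 - q) * / (1 - q) * (q * q ^ N)) by ring.
    apply Rmult_le_compat_l.
    - apply Rmult_le_pos; [|lra]. apply Rmult_le_pos; lra.
    - apply Rmult_le_compat_r; trivial.
      rewrite S_INR. generalize (pos_INR N). lra. }
  unfold C. rewrite Rmult_plus_distr_r. lra. }
apply is_lim_seq_ext with (fun N =>
   (sum_n (fun n => sum_n (fun k => b k (n - k)%nat) n) N - S0) + S0).
- intros n. simpl. ring.
- replace (Finite S0) with (Finite (0 + S0)) by (f_equal; ring).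
  apply is_lim_seq_plus'; trivial. apply is_lim_seq_const.
Qed.

Lemma Series_PS2 (a : nat -> nat -> R) (x y : R) :
  Series (fun j => Series (fun k => x ^ j * y ^ k * a j k)) = PS2 a x y.
Proof.
unfold PS2, PSeries. apply Series_ext. intros j.
rewrite <- Series_scal_r. apply Series_ext. intros k. ring.
Qed.

Lemma pow_max_bound (x y r : R) (j k : nat) :
  0 < r -> Rabs x * r <= / 2 -> Rabs y * r <= / 2 ->
  Rabs (x ^ j * y ^ k) * r ^ (j + k) <= (/ 2) ^ (j + k).
Proof.
intros Hr Hx Hy.
rewrite Rabs_mult, <- !RPow_abs, !pow_add.
replace (_ * _ * _) with ((Rabs x * r) ^ j * (Rabs y * r) ^ k)
  by (rewrite !Rpow_mult_distr; ring).
assert (H1 : 0 <= Rabs x * r) by (apply Rmult_le_pos; [apply Rabs_pos|lra]).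
assert (H2 : 0 <= Rabs y * r) by (apply Rmult_le_pos; [apply Rabs_pos|lra]).
apply Rmult_le_compat; try (now apply pow_le); now apply pow_incr.
Qed.

Lemma geo2_term (M r : R) (a : nat -> nat -> R) (x y : R) (j k : nat) :
  0 < r -> geo2 M r a -> Rabs x * r <= / 2 -> Rabs y * r <= / 2 ->
  Rabs (x ^ j * y ^ k * a j k) <= M * (/ 2) ^ (j + k).
Proof.
intros Hr Ha Hx Hy.
assert (HM := geo2_nonneg _ _ _ Ha).
rewrite Rabs_mult.
apply Rle_trans with (Rabs (x ^ j * y ^ k) * (M * r ^ (j + k))).
- apply Rmult_le_compat_l; [apply Rabs_pos | apply Ha].
- rewrite (Rmult_comm M), <- Rmult_assoc, Rmult_comm.
  apply Rmult_le_compat_l; trivial. now apply pow_max_bound.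
Qed.

Lemma is_series_PS2 (M r : R) (a : nat -> nat -> R) (x y : R) :
  0 < r -> geo2 M r a -> Rabs x * r <= / 2 -> Rabs y * r <= / 2 ->
  is_series (fun n => sum_n (fun k => x ^ k * y ^ (n - k) * a k (n - k)%nat) n)
    (PS2 a x y).
Proof.
intros Hr Ha Hx Hy. rewrite <- Series_PS2.
apply (is_series_diag (fun j k => x ^ j * y ^ k * a j k) M (/ 2)); [lra|].
intros j k. now apply geo2_term with r.
Qed.

Lemma ex_series_Rabs_PS2 (M r : R) (a : nat -> nat -> R) (x y : R) :
  0 < r -> geo2 M r a -> Rabs x * r <= / 2 -> Rabs y * r <= / 2 ->
  ex_series (fun n =>
    sum_n (fun k => Rabs (x ^ k * y ^ (n - k) * a k (n - k)%nat)) n).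
Proof.
intros Hr Ha Hx Hy. eexists.
apply (is_series_diag (fun j k => Rabs (x ^ j * y ^ k * a j k)) M (/ 2)); [lra|].
intros j k. rewrite Rabs_Rabsolu. now apply geo2_term with r.
Qed.


Lemma sum_n_rev (u : nat -> R) (n : nat) :
  sum_n (fun k => u (n - k)%nat) n = sum_n u n.
Proof.
revert u. induction n as [|n IH]; intros u; [now rewrite !sum_O|].
rewrite sum_Sn, Nat.sub_diag.
rewrite (sum_n_ext_loc _ (fun k => u (S (n - k))%nat)).
2: intros k Hk; f_equal; lia.
rewrite (IH (fun k => u (S k))).
unfold sum_n. rewrite (sum_Sn_m u 0) by lia.
rewrite <- sum_n_m_S. apply plus_comm.
Qed.

(** Both iterated sums equal the sum by homogeneous degree, and reversing the inner finite sum
    exchanges the two indices. *)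
Lemma PS2_swap (M r : R) (a : nat -> nat -> R) (x y : R) :
  0 < r -> geo2 M r a -> Rabs x * r <= / 2 -> Rabs y * r <= / 2 ->
  PS2 a x y = PS2 (fun j k => a k j) y x.
Proof.
intros Hr Ha Hx Hy.
rewrite <- (is_series_unique _ _ (is_series_PS2 M r a x y Hr Ha Hx Hy)).
apply is_series_unique.
apply is_series_ext with (fun n =>
   sum_n (fun k => y ^ k * x ^ (n - k) * a (n - k)%nat k) n).
- intros n. rewrite <- sum_n_rev. apply sum_n_ext_loc. intros k Hk.
  replace (n - (n - k))%nat with k by lia. simpl; ring.
- apply (is_series_PS2 M r (fun j k => a k j)); trivial.
  intros j k. rewrite Nat.add_comm. apply Ha.
Qed.

(** Analyticity with its witnesses exposed: the bound and the box enter quantitatively when a series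
    is differentiated, recentred or used in a differential equation. *)
Definition rep2 (f : R -> R -> R) (x0 y0 M r : R) (a : nat -> nat -> R) : Prop :=
  0 < r /\ geo2 M r a /\
  forall x y, Rabs (x - x0) * r <= / 2 -> Rabs (y - y0) * r <= / 2 ->
    f x y = PS2 a (x - x0) (y - y0).

Lemma rep2_weaken (f : R -> R -> R) (x0 y0 M M' r r' : R) (a : nat -> nat -> R) :
  M <= M' -> r <= r' -> rep2 f x0 y0 M r a -> rep2 f x0 y0 M' r' a.
Proof.
intros HM Hr (Hr0 & Ha & Hf). split; [lra|]. split.
- apply (geo2_weaken M M' r r'); trivial. lra.
- intros x y Hx Hy. apply Hf.
  + apply Rle_trans with (2 := Hx). apply Rmult_le_compat_l; trivial.
    apply Rabs_pos.
  + apply Rle_trans with (2 := Hy). apply Rmult_le_compat_l; trivial.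
    apply Rabs_pos.
Qed.

(** * Coordinates of vector-valued series and of analytic maps *)

Definition coordinate (c : R3 -> R) : Prop :=
  c = vec_x \/ c = vec_y \/ c = vec_z.

Lemma coordinate_plus (c : R3 -> R) (u v : R3) :
  coordinate c -> c (plus u v) = c u + c v.
Proof. now intros [-> | [-> | ->]]. Qed.

Lemma coordinate_scal (c : R3 -> R) (k : R) (v : R3) :
  coordinate c -> c (scal k v) = k * c v.
Proof. now intros [-> | [-> | ->]]. Qed.

Lemma coordinate_norm (c : R3 -> R) (v : R3) :
  coordinate c -> Rabs (c v) <= norm v.
Proof.
assert (H1 : forall (U V : NormedModule R_AbsRing) (u : U * V),
  norm (fst u) <= norm u /\ norm (snd u) <= norm u).
{ intros U V u. unfold norm at 2 4; simpl. unfold prod_norm. split.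
  - rewrite <- (sqrt_pow2 (norm (fst u))) at 1 by apply norm_ge_0.
    apply sqrt_le_1_alt. generalize (pow2_ge_0 (norm (snd u))). lra.
  - rewrite <- (sqrt_pow2 (norm (snd u))) at 1 by apply norm_ge_0.
    apply sqrt_le_1_alt. generalize (pow2_ge_0 (norm (fst u))). lra. }
destruct (H1 _ _ v) as [Hf Hz]. destruct (H1 _ _ (fst v)) as [Hx Hy].
intros [-> | [-> | ->]]; [| | exact Hz].
- exact (Rle_trans _ _ _ Hx Hf).
- exact (Rle_trans _ _ _ Hy Hf).
Qed.

Lemma coordinate_sum_n (c : R3 -> R) (u : nat -> R3) (n : nat) :
  coordinate c -> c (sum_n u n) = sum_n (fun k => c (u k)) n.
Proof.
intros Hc. induction n as [|n IH]; [now rewrite !sum_O|].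
now rewrite !sum_Sn, coordinate_plus, IH.
Qed.

Lemma coordinate_is_series (c : R3 -> R) (u : nat -> R3) (l : R3) :
  coordinate c -> is_series u l -> is_series (fun n => c (u n)) (c l).
Proof.
intros Hc Hu. apply filterlim_locally. intros eps.
generalize (proj1 (filterlim_locally _ _) Hu eps).
apply filter_imp. intros n.
intros [[Hx Hy] Hz].
change (ball (c l) eps (sum_n (fun k => c (u k)) n)).
rewrite <- (coordinate_sum_n c u n Hc).
now destruct Hc as [-> | [-> | ->]].
Qed.

Lemma is_series_coordinates (u : nat -> R3) (l : R3) :
  (forall c, coordinate c -> is_series (fun n => c (u n)) (c l)) ->
  is_series u l.
Proof.
intros H. apply filterlim_locally. intros eps.
assert (Hc : forall c, coordinate c ->
  eventually (fun n => ball (c l) eps (c (sum_n u n)))).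
{ intros c Hc. generalize (proj1 (filterlim_locally _ _) (H c Hc) eps).
  apply filter_imp. intros n Hb. rewrite coordinate_sum_n by trivial. exact Hb. }
assert (Hx := Hc vec_x (or_introl eq_refl)).
assert (Hy := Hc vec_y (or_intror (or_introl eq_refl))).
assert (Hz := Hc vec_z (or_intror (or_intror eq_refl))).
generalize (filter_and _ _ (filter_and _ _ Hx Hy) Hz).
now apply filter_imp.
Qed.

Lemma ex_series_bounded (u : nat -> R) :
  ex_series u -> exists T, forall n, Rabs (u n) <= T.
Proof.
intros Hu.
assert (Hl := ex_series_lim_0 _ Hu).
destruct (maj_by_pos u) as [T [_ HT]].
- exists 0. now apply is_lim_seq_Reals.
- now exists T.
Qed.

Lemma sum_n_nonneg_term (u : nat -> R) (n k : nat) :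
  (forall i, 0 <= u i) -> (k <= n)%nat -> u k <= sum_n u n.
Proof.
intros Hu. induction n as [|n IH]; intros Hk.
- replace k with 0%nat by lia. rewrite sum_O. lra.
- rewrite sum_Sn. unfold plus; simpl.
  destruct (Nat.eq_dec k (S n)) as [->|Hne].
  + assert (0 <= sum_n u n); [|lra].
    clear -Hu. induction n as [|n IH]; [now rewrite sum_O|].
    rewrite sum_Sn. unfold plus; simpl. specialize (Hu (S n)). lra.
  + generalize (IH ltac:(lia)) (Hu (S n)). lra.
Qed.

(** A Cauchy estimate by real means: absolute convergence at the single point
    [(x0 + r0 / 2, y0 + r0 / 2)] bounds all terms there by a common [T], hence the coefficients by
    [T * (2 / r0) ^ (j + k)]. *)
Lemma analytic2_at_rep2 (f : R -> R -> R3) (x0 y0 : R) (c : R3 -> R) :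
  coordinate c -> analytic2_at f x0 y0 ->
  exists M r a, rep2 (fun x y => c (f x y)) x0 y0 M r a.
Proof.
intros Hc (A & r0 & Hr0 & HA).
assert (Habs : Rabs (r0 / 2) < r0) by (rewrite Rabs_right; lra).
destruct (HA (x0 + r0 / 2) (y0 + r0 / 2)) as [Hn _];
  try (replace (_ + r0 / 2 - _) with (r0 / 2) by ring; trivial).
destruct (ex_series_bounded _ Hn) as [T HT]. clear Hn.
assert (Hr : 0 < 2 / r0) by (apply Rdiv_lt_0_compat; lra).
assert (Hgeo : geo2 T (2 / r0) (fun j k => c (A j k))).
{ intros j k.
  assert (Hjk : Rabs ((r0 / 2) ^ (j + k) * c (A j k)) <= T).
  { apply Rle_trans with (2 := HT (j + k)%nat).
    apply Rle_trans with (2 := Rle_abs _).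
    (* One term is at most the whole diagonal sum of norms, because the other terms are
       nonnegative. *)
    set (g := fun k => _).
    apply Rle_trans with (g j).
    - unfold g. replace (j + k - j)%nat with k by lia.
      replace (x0 + r0 / 2 - x0) with (r0 / 2) by ring.
      replace (y0 + r0 / 2 - y0) with (r0 / 2) by ring.
      rewrite <- pow_add, <- coordinate_scal by trivial.
      now apply coordinate_norm.
    - apply sum_n_nonneg_term; [|lia]. intros i. apply norm_ge_0. }
  rewrite Rabs_mult, Rabs_right in Hjk
    by (apply Rle_ge, pow_le; lra).
  replace (2 / r0) with (/ (r0 / 2)) by (field; lra).
  assert (Hp : 0 < (r0 / 2) ^ (j + k)) by (apply pow_lt; lra).
  rewrite pow_inv. apply Rmult_le_reg_l with (1 := Hp).
  replace (_ * (T * _)) with T; trivial. field. lra. }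
exists T, (2 / r0), (fun j k => c (A j k)).
split; [trivial|]. split; [trivial|].
intros x y Hx Hy.
assert (Hsm : forall z, Rabs z * (2 / r0) <= / 2 -> Rabs z < r0).
{ intros z Hz. apply Rmult_lt_reg_r with (2 / r0); trivial.
  replace (r0 * (2 / r0)) with 2 by (field; lra). lra. }
destruct (HA x y (Hsm _ Hx) (Hsm _ Hy)) as [_ Hs].
rewrite <- (is_series_unique _ _ (coordinate_is_series c _ _ Hc Hs)).
apply is_series_unique.
refine (is_series_ext _ _ _ _ (is_series_PS2 T (2 / r0) _ _ _ Hr Hgeo Hx Hy)).
intros n. rewrite coordinate_sum_n by trivial.
apply sum_n_ext. intros k. now rewrite coordinate_scal.
Qed.

Lemma norm_R3_le (v : R3) :
  norm v <= Rabs (vec_x v) + Rabs (vec_y v) + Rabs (vec_z v).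
Proof.
assert (H1 : forall (U V : NormedModule R_AbsRing) (u : U * V),
  norm u <= norm (fst u) + norm (snd u)).
{ intros U V u. unfold norm at 1; simpl. unfold prod_norm.
  assert (Hf := norm_ge_0 (fst u)). assert (Hs := norm_ge_0 (snd u)).
  rewrite <- (sqrt_pow2 (norm (fst u) + norm (snd u))) by lra.
  apply sqrt_le_1_alt. nra. }
apply Rle_trans with (1 := H1 _ _ v).
apply Rplus_le_compat; [exact (H1 _ _ (fst v)) | apply Rle_refl].
Qed.

Lemma rep2_analytic2_at (f : R -> R -> R3) (x0 y0 M r : R)
    (ax ay az : nat -> nat -> R) :
  rep2 (fun x y => vec_x (f x y)) x0 y0 M r ax ->
  rep2 (fun x y => vec_y (f x y)) x0 y0 M r ay ->
  rep2 (fun x y => vec_z (f x y)) x0 y0 M r az ->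
  analytic2_at f x0 y0.
Proof.
intros (Hr & Gx & Fx) (_ & Gy & Fy) (_ & Gz & Fz).
(* The radius [/ (2 * r)] places the points of [analytic2_at] in the box [|z| * r <= / 2]. *)
exists (fun j k => (ax j k, ay j k, az j k)), (/ (2 * r)).
split; [apply Rinv_0_lt_compat; lra|].
intros x y Hx Hy term.
assert (Hsm : forall z, Rabs z < / (2 * r) -> Rabs z * r <= / 2).
{ intros z Hz. apply Rlt_le, Rmult_lt_reg_r with (/ r).
  - now apply Rinv_0_lt_compat.
  - rewrite Rmult_assoc, Rinv_r, Rmult_1_r, <- Rinv_mult; lra. }
apply Hsm in Hx, Hy.
split.
- apply (@ex_series_le R_AbsRing R_CompleteNormedModule) with (fun n =>
    plus (plus
     (sum_n (fun k => Rabs ((x - x0) ^ k * (y - y0) ^ (n - k) * ax k (n - k)%nat)) n)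
     (sum_n (fun k => Rabs ((x - x0) ^ k * (y - y0) ^ (n - k) * ay k (n - k)%nat)) n))
     (sum_n (fun k => Rabs ((x - x0) ^ k * (y - y0) ^ (n - k) * az k (n - k)%nat)) n)).
  2: { apply @ex_series_plus; [apply @ex_series_plus|];
       now apply ex_series_Rabs_PS2 with M r. }
  intros n. rewrite <- !sum_n_plus. apply Rabs_sum_n_le.
  intros k _. rewrite Rabs_right by apply Rle_ge, norm_ge_0.
  apply norm_R3_le.
- apply is_series_coordinates. intros c Hc.
  apply is_series_ext with (fun n =>
    sum_n (fun k => (x - x0) ^ k * (y - y0) ^ (n - k) *
       c (ax k (n - k)%nat, ay k (n - k)%nat, az k (n - k)%nat)) n).
  { intros n. rewrite coordinate_sum_n by trivial. apply sum_n_ext.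
    intros k. unfold term. now rewrite coordinate_scal. }
  destruct Hc as [-> | [-> | ->]].
  + rewrite (Fx x y Hx Hy). now apply is_series_PS2 with M r.
  + rewrite (Fy x y Hx Hy). now apply is_series_PS2 with M r.
  + rewrite (Fz x y Hx Hy). now apply is_series_PS2 with M r.
Qed.

(** * Term-by-term differentiation and recentering *)

Definition dx (a : nat -> nat -> R) (j k : nat) : R := INR (S j) * a (S j) k.
Definition dy (a : nat -> nat -> R) (j k : nat) : R := INR (S k) * a j (S k).

Lemma INR_le_pow2 (n : nat) : INR (S n) <= 2 ^ n.
Proof.
induction n as [|n IH]; [simpl; lra|].
rewrite S_INR. change (2 ^ S n) with (2 * 2 ^ n).
assert (1 <= 2 ^ n) by (apply pow_R1_Rle; lra). lra.
Qed.

(** The factor [j + 1 <= 2 ^ j] is absorbed by doubling [r]. *)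
Lemma geo2_dx (M r : R) (a : nat -> nat -> R) :
  0 < r -> geo2 M r a -> geo2 (M * r) (2 * r) (dx a).
Proof.
intros Hr Ha j k. unfold dx.
assert (HM := geo2_nonneg _ _ _ Ha).
rewrite Rabs_mult, Rabs_right by apply Rle_ge, pos_INR.
apply Rle_trans with (2 ^ (j + k) * (M * r ^ S (j + k))).
- apply Rmult_le_compat; [apply pos_INR | apply Rabs_pos | | apply Ha].
  apply Rle_trans with (1 := INR_le_pow2 j). apply Rle_pow; [lra|lia].
- rewrite Rpow_mult_distr. apply Req_le. simpl. ring.
Qed.

Lemma is_derive_PS2_x (M r : R) (a : nat -> nat -> R) (x y : R) :
  0 < r -> geo2 M r a -> Rabs x * r <= / 2 -> Rabs y * r <= / 2 ->
  is_derive (fun x => PS2 a x y) x (PS2 (dx a) x y).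
Proof.
intros Hr Ha Hx Hy.
replace (PS2 (dx a) x y) with
  (PSeries (PS_derive (fun j => PSeries (a j) y)) x).
- apply (is_derive_PSeries (fun j => PSeries (a j) y)).
  apply geo1_CV_radius with (2 * M) r; trivial; [|lra].
  now apply geo2_geo1.
- unfold PS2. apply PSeries_ext. intros j. unfold PS_derive.
  rewrite <- (PSeries_scal (INR (S j))). now apply PSeries_ext.
Qed.

Lemma locally_Rabs_mult_lt (x r C : R) :
  Rabs x * r < C -> locally x (fun z => Rabs z * r < C).
Proof.
intros H.
assert (Hc : continuous (fun z => Rabs z * r) x).
{ apply (continuous_mult (K := R_AbsRing) Rabs (fun _ => r));
  [apply continuous_Rabs | apply continuous_const]. }
apply (Hc (fun v => v < C)). now apply open_lt.
Qed.

(** Reduced to the other variable by [PS2_swap]. The bound on [y] is strict because the swapped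
    series must agree with the original on a neighbourhood of [y]. *)
Lemma is_derive_PS2_y (M M' r : R) (a : nat -> nat -> R) (x y : R) :
  0 < r -> geo2 M r a -> geo2 M' r (dy a) ->
  Rabs x * r <= / 2 -> Rabs y * r < / 2 ->
  is_derive (fun y => PS2 a x y) y (PS2 (dy a) x y).
Proof.
intros Hr Ha Hd Hx Hy.
apply is_derive_ext_loc with (fun y => PS2 (fun j k => a k j) y x).
- generalize (locally_Rabs_mult_lt _ _ _ Hy). apply filter_imp.
  intros z Hz. symmetry. apply PS2_swap with M r; trivial. lra.
- rewrite (PS2_swap M' r) by (trivial; lra).
  apply (is_derive_PS2_x M r (fun j k => a k j)); trivial; [|lra].
  intros j k. rewrite Nat.add_comm. apply Ha.
Qed.

(** Parametrising the segment from [x] to [x + h] by [t] in [[0, 1]] makes the Taylor-Lagrange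
    formula apply for either sign of [h]. The factorial bounds then make the remainder at most
    [M * (|h| * C) ^ (n + 1)]. *)
Lemma Taylor_series (G : nat -> R -> R) (M C x h R0 : R) :
  0 < C ->
  (forall l z, Rabs z < R0 -> is_derive (G l) z (G (S l) z)) ->
  (forall l z, Rabs z < R0 -> Rabs (G l z) <= M * INR (fact l) * C ^ l) ->
  Rabs x < R0 -> Rabs (x + h) < R0 -> Rabs h * C < 1 ->
  PSeries (fun l => G l x / INR (fact l)) h = G 0%nat (x + h).
Proof.
intros HC HG HM Hx Hxh Hh.
set (H := fun l t => h ^ l * G l (x + t * h)).
set (U := fun t => Rabs (x + t * h) < R0).
assert (HU : forall t, U t -> locally t U).
{ intros t Ht.
  assert (Hc : continuous (fun t => Rabs (x + t * h)) t).
  { apply (continuous_comp (fun t => x + t * h) Rabs); [|apply continuous_Rabs].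
    apply @ex_derive_continuous. now auto_derive. }
  apply (Hc (fun v => v < R0)). now apply open_lt. }
assert (H01 : forall t, 0 <= t <= 1 -> U t).
{ intros t Ht. unfold U.
  replace (x + t * h) with ((1 - t) * x + t * (x + h)) by ring.
  apply Rle_lt_trans with (1 := Rabs_triang _ _).
  rewrite !Rabs_mult, (Rabs_right (1 - t)), (Rabs_right t) by lra.
  destruct (Req_dec t 0) as [->|Ht0]; nra. }
assert (HD : forall l t, U t -> is_derive (H l) t (H (S l) t)).
{ intros l t Ht. unfold H.
  assert (HGl := HG l (x + t * h) Ht).
  replace (h ^ S l * G (S l) (x + t * h)) with
    (h ^ l * (h * G (S l) (x + t * h))) by (simpl; ring).
  apply @is_derive_scal.
  apply (is_derive_comp (G l) (fun t => x + t * h)); trivial.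
  auto_derive; trivial. ring. }
assert (HDn : forall l t, U t -> is_derive_n (H 0%nat) l t (H l t)).
{ induction l as [|l IH]; intros t Ht; [reflexivity|].
  apply is_derive_ext_loc with (H l); [|now apply HD].
  generalize (HU t Ht). apply filter_imp. intros u Hu.
  symmetry. now apply is_derive_n_unique, IH. }
apply is_pseries_unique.
assert (Hser : is_lim_seq
   (sum_n (fun l => G l x / INR (fact l) * h ^ l)) (G 0%nat (x + h))).
{ assert (Hlim : is_lim_seq (fun n => M * (Rabs h * C) ^ S n) 0).
  { replace (Finite 0) with (Rbar_mult M 0) by (simpl; f_equal; ring).
    apply is_lim_seq_scal_l.
    apply (is_lim_seq_incr_1 (fun n => (Rabs h * C) ^ n)).
    apply is_lim_seq_geom. rewrite Rabs_right; trivial.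
    apply Rle_ge, Rmult_le_pos; [apply Rabs_pos | lra]. }
  apply is_lim_seq_ext with (fun n =>
    (sum_n (fun l => G l x / INR (fact l) * h ^ l) n - G 0%nat (x + h))
      + G 0%nat (x + h)).
  { intros n. simpl. ring. }
  replace (Finite (G 0%nat (x + h))) with (Finite (0 + G 0%nat (x + h)))
    by (f_equal; ring).
  apply is_lim_seq_plus'; [|apply is_lim_seq_const].
  apply is_lim_seq_abs_0.
  apply is_lim_seq_le_le with (fun _ => 0) (fun n => M * (Rabs h * C) ^ S n);
    trivial; [|apply is_lim_seq_const].
  intros n. split; [apply Rabs_pos|].
  destruct (Taylor_Lagrange (H 0%nat) n 0 1) as [z [Hz E]]; [lra| |].
  { intros t Ht k _. destruct k as [|k]; [exact I|].
    eexists. apply (HDn (S k)). now apply H01. }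
  assert (Uz : U z) by (apply H01; lra).
  rewrite (is_derive_n_unique _ _ _ _ (HDn (S n) z Uz)) in E.
  replace (H 0%nat 1) with (G 0%nat (x + h)) in E
    by (unfold H; simpl; rewrite !Rmult_1_l; reflexivity).
  rewrite (sum_eq _ (fun l => G l x / INR (fact l) * h ^ l)) in E.
  2: { intros i _.
    rewrite (is_derive_n_unique _ _ _ _ (HDn i 0 (H01 0 ltac:(lra)))).
    unfold H. rewrite Rmult_0_l, Rplus_0_r, Rminus_0_r, pow1.
    field. apply INR_fact_neq_0. }
  rewrite E, sum_n_Reals.
  set (s := sum_f_R0 _ n).
  replace (s - (s + _)) with (- ((1 - 0) ^ S n / INR (fact (S n)) * H (S n) z))
    by ring.
  rewrite Rabs_Ropp, Rminus_0_r, pow1. unfold H.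
  assert (Hf : 0 < INR (fact (S n))) by apply INR_fact_lt_0.
  unfold Rdiv. rewrite Rmult_1_l, !Rabs_mult, Rabs_right
    by (apply Rle_ge, Rlt_le, Rinv_0_lt_compat, Hf).
  rewrite <- RPow_abs, Rpow_mult_distr.
  apply Rmult_le_reg_l with (1 := Hf).
  rewrite <- Rmult_assoc, Rinv_r, Rmult_1_l by lra.
  replace (INR (fact (S n)) * (M * (Rabs h ^ S n * C ^ S n))) with
    (Rabs h ^ S n * (M * INR (fact (S n)) * C ^ S n)) by ring.
  apply Rmult_le_compat_l; [apply pow_le, Rabs_pos|].
  now apply HM. }
apply is_pseries_R. exact Hser.
Qed.

(** A binomial coefficient of order [j + l] is at most [2 ^ (j + l)]; the double induction is
    Pascal's rule cleared of denominators. *)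
Lemma fact_add_le (j l : nat) :
  INR (fact (j + l)) <= 2 ^ (j + l) * (INR (fact j) * INR (fact l)).
Proof.
revert l. induction j as [|j IHj]; intros l.
- simpl. assert (1 <= 2 ^ l) by (apply pow_R1_Rle; lra).
  assert (0 < INR (fact l)) by apply INR_fact_lt_0. nra.
- induction l as [|l IHl].
  + rewrite Nat.add_0_r. change (fact 0) with 1%nat. rewrite INR_1, Rmult_1_r.
    assert (1 <= 2 ^ S j) by (apply pow_R1_Rle; lra).
    assert (0 < INR (fact (S j))) by apply INR_fact_lt_0. nra.
  + specialize (IHj (S l)).
    replace (j + S l)%nat with (S j + l)%nat in IHj by lia.
    replace (S j + S l)%nat with (S (S j + l)) by lia.
    rewrite fact_simpl, mult_INR.
    replace (INR (S (S j + l))) with (INR (S j) + INR (S l))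
      by (rewrite <- plus_INR; f_equal; lia).
    change (2 ^ S (S j + l)) with (2 * 2 ^ (S j + l)).
    rewrite (fact_simpl j), (fact_simpl l), !mult_INR in *.
    set (A := INR (fact (S j + l))) in *.
    set (P := 2 ^ (S j + l)) in *.
    assert (0 <= INR (S j)) by apply pos_INR.
    assert (0 <= INR (S l)) by apply pos_INR.
    apply (Rmult_le_compat_l (INR (S j))) in IHj; trivial.
    apply (Rmult_le_compat_l (INR (S l))) in IHl; trivial.
    lra.
Qed.

(** The closed form of an iterated derivative, of order [l] in [x] and [m] in [y]. Iterating
    [geo2_dx] would double [r] at each order, while [geo2_Dn] doubles it once for all orders. *)
Definition Dn (l m : nat) (a : nat -> nat -> R) (j k : nat) : R :=
  INR (fact (j + l)) / INR (fact j) * (INR (fact (k + m)) / INR (fact k))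
    * a (j + l)%nat (k + m)%nat.

Lemma Dn_0_0 (a : nat -> nat -> R) : Dn 0 0 a = a.
Proof.
apply functional_extensionality. intros j.
apply functional_extensionality. intros k. unfold Dn.
rewrite !Nat.add_0_r. field. split; apply INR_fact_neq_0.
Qed.

Lemma fact_div_S (j l : nat) :
  INR (S j) * (INR (fact (S j + l)) / INR (fact (S j))) =
  INR (fact (j + S l)) / INR (fact j).
Proof.
replace (j + S l)%nat with (S j + l)%nat by lia.
rewrite (fact_simpl j), mult_INR. field.
split; [apply INR_fact_neq_0 | apply not_0_INR; lia].
Qed.

Lemma dx_Dn (l m : nat) (a : nat -> nat -> R) : dx (Dn l m a) = Dn (S l) m a.
Proof.
apply functional_extensionality. intros j.
apply functional_extensionality. intros k. unfold dx, Dn.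
rewrite <- (fact_div_S j l), !Rmult_assoc.
now replace (j + S l)%nat with (S j + l)%nat by lia.
Qed.

Lemma dy_Dn (l m : nat) (a : nat -> nat -> R) : dy (Dn l m a) = Dn l (S m) a.
Proof.
apply functional_extensionality. intros j.
apply functional_extensionality. intros k. unfold dy, Dn.
rewrite <- (fact_div_S k m).
replace (k + S m)%nat with (S k + m)%nat by lia. ring.
Qed.

Lemma geo2_Dn (M r : R) (l m : nat) (a : nat -> nat -> R) :
  0 < r -> geo2 M r a ->
  geo2 (M * (INR (fact l) * (2 * r) ^ l) * (INR (fact m) * (2 * r) ^ m))
    (2 * r) (Dn l m a).
Proof.
intros Hr Ha j k. unfold Dn.
assert (HF : forall j l, 0 <= INR (fact (j + l)) / INR (fact j)
    <= 2 ^ (j + l) * INR (fact l)).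
{ clear. intros j l.
  assert (Hj : 0 < INR (fact j)) by apply INR_fact_lt_0.
  split.
  - apply Rlt_le, Rdiv_lt_0_compat; trivial. apply INR_fact_lt_0.
  - apply Rle_div_l; trivial. generalize (fact_add_le j l). lra. }
destruct (HF j l) as [H1 H2]. destruct (HF k m) as [H3 H4].
rewrite !Rabs_mult, (Rabs_right (_ / _)), (Rabs_right (_ / _)) by lra.
apply Rle_trans with
  (2 ^ (j + l) * INR (fact l) * (2 ^ (k + m) * INR (fact m))
    * (M * r ^ (j + l + (k + m)))).
- apply Rmult_le_compat; [now apply Rmult_le_pos | apply Rabs_pos | | apply Ha].
  now apply Rmult_le_compat.
- apply Req_le. rewrite !Rpow_mult_distr, !pow_add. ring.
Qed.

Definition recenter (a : nat -> nat -> R) (x y : R) (l m : nat) : R :=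
  PS2 (Dn l m a) x y / INR (fact m) / INR (fact l).

Lemma geo2_recenter (M r : R) (a : nat -> nat -> R) (x y : R) :
  0 < r -> geo2 M r a ->
  Rabs x * (2 * r) <= / 2 -> Rabs y * (2 * r) <= / 2 ->
  geo2 (4 * M) (2 * r) (recenter a x y).
Proof.
intros Hr Ha Hx Hy l m. unfold recenter.
assert (H2r : 0 < 2 * r) by lra.
assert (Hl : 0 < INR (fact l)) by apply INR_fact_lt_0.
assert (Hm : 0 < INR (fact m)) by apply INR_fact_lt_0.
unfold Rdiv. rewrite !Rabs_mult, !Rabs_inv, (Rabs_right (INR (fact m))),
  (Rabs_right (INR (fact l))) by lra.
apply Rle_div_l; trivial. apply Rle_div_l; trivial.
apply Rle_trans with (1 := PS2_geo2 _ _ _ _ _ H2r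
  (geo2_Dn M r l m a Hr Ha) Hx Hy).
apply Req_le. rewrite pow_add. ring.
Qed.

(** Taylor's expansion is applied in each variable separately. The bounds [/ 4] keep both the old
    point and the displaced one in the half box at the rate [2 * r] of the derivatives. *)
Lemma PS2_recenter (M r : R) (a : nat -> nat -> R) (x y h k : R) :
  0 < r -> geo2 M r a ->
  Rabs x * (2 * r) <= / 4 -> Rabs y * (2 * r) <= / 4 ->
  Rabs h * (2 * r) < / 4 -> Rabs k * (2 * r) < / 4 ->
  PS2 a (x + h) (y + k) = PS2 (recenter a x y) h k.
Proof.
intros Hr Ha Hx Hy Hh Hk.
assert (H2r : 0 < 2 * r) by lra.
set (R0 := / (4 * r)).
assert (HR0 : forall z, Rabs z < R0 <-> Rabs z * (2 * r) < / 2).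
{ intros z.
  assert (E : R0 * (2 * r) = / 2) by (unfold R0; field; lra).
  split; intros Hz.
  - rewrite <- E. apply Rmult_lt_compat_r; lra.
  - apply Rmult_lt_reg_r with (2 * r); lra. }
assert (Hsum : forall u v, Rabs u * (2 * r) <= / 4 -> Rabs v * (2 * r) < / 4 ->
  Rabs (u + v) < R0).
{ intros u v Hu Hv. apply HR0.
  apply Rle_lt_trans with ((Rabs u + Rabs v) * (2 * r)); [|lra].
  apply Rmult_le_compat_r; [lra | apply Rabs_triang]. }
unfold PS2 at 2, recenter.
rewrite (PSeries_ext _ (fun l => PS2 (Dn l 0 a) x (y + k) / INR (fact l))).
- rewrite (Taylor_series (fun l z => PS2 (Dn l 0 a) z (y + k))
    (4 * M) (2 * r) x h R0); trivial; try lra.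
  + now rewrite Dn_0_0.
  + intros l z Hz. rewrite <- dx_Dn. apply HR0 in Hz.
    apply is_derive_PS2_x with (2 := geo2_Dn M r l 0 a Hr Ha); try lra.
    apply Rlt_le, HR0, Hsum; trivial.
  + intros l z Hz. apply HR0 in Hz.
    apply Rle_trans with (1 := PS2_geo2 _ _ _ z (y + k) H2r
      (geo2_Dn M r l 0 a Hr Ha) ltac:(lra)
      (Rlt_le _ _ (proj1 (HR0 _) (Hsum _ _ Hy Hk)))).
    apply Req_le. simpl. ring.
  + apply HR0. lra.
  + now apply Hsum.
- intros l.
  rewrite <- (Taylor_series (fun m z => PS2 (Dn l m a) x z)
    (4 * M * (INR (fact l) * (2 * r) ^ l)) (2 * r) y k R0); trivial; try lra.
  + unfold Rdiv at 3. rewrite Rmult_comm, <- PSeries_scal.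
    apply PSeries_ext. intros m. unfold PS_scal, scal; simpl; unfold mult; simpl.
    unfold Rdiv. ring.
  + intros m z Hz. rewrite <- dy_Dn. apply HR0 in Hz.
    apply is_derive_PS2_y with (2 := geo2_Dn M r l m a Hr Ha)
      (M' := M * (INR (fact l) * (2 * r) ^ l) *
        (INR (fact (S m)) * (2 * r) ^ S m)); try lra.
    rewrite dy_Dn. now apply geo2_Dn.
  + intros m z Hz. apply HR0 in Hz.
    apply Rle_trans with (1 := PS2_geo2 _ _ _ x z H2r
      (geo2_Dn M r l m a Hr Ha) ltac:(lra) ltac:(lra)).
    apply Req_le. ring.
  + apply HR0. lra.
  + now apply Hsum.
Qed.

(** This turns a representation at one point into analyticity at every nearby point. The rate
    [8 * r] makes the displacement bounds of [PS2_recenter] strict. *)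
Lemma rep2_recenter (f : R -> R -> R) (x0 y0 M r : R) (a : nat -> nat -> R) (x y : R) :
  rep2 f x0 y0 M r a ->
  Rabs (x - x0) * (2 * r) <= / 4 -> Rabs (y - y0) * (2 * r) <= / 4 ->
  rep2 f x y (4 * M) (8 * r) (recenter a (x - x0) (y - y0)).
Proof.
intros (Hr & Ha & Hf) Hx Hy. split; [lra|]. split.
- assert (HM := geo2_nonneg _ _ _ Ha).
  apply geo2_weaken with (4 * M) (2 * r); try lra.
  apply geo2_recenter; trivial; lra.
- intros u v Hu Hv.
  rewrite <- (PS2_recenter M r) by (trivial; lra).
  replace (x - x0 + (u - x)) with (u - x0) by ring.
  replace (y - y0 + (v - y)) with (v - y0) by ring.
  assert (Hs : forall p q z, Rabs (p - z) * (2 * r) <= / 4 ->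
     Rabs (q - p) * (8 * r) <= / 2 -> Rabs (q - z) * r <= / 2).
  { intros p q z Hp Hq.
    replace (q - z) with ((q - p) + (p - z)) by ring.
    apply Rle_trans with ((Rabs (q - p) + Rabs (p - z)) * r).
    - apply Rmult_le_compat_r; [lra | apply Rabs_triang].
    - lra. }
  apply Hf; [now apply (Hs x) | now apply (Hs y)].
Qed.

(** * Polynomial differential equations *)

(** Nesting [PS_mult] in [y] inside a Cauchy product in [x] reduces [PS2_conv] to the one-variable
    product theorem, applied once per variable. *)
Definition conv (a b : nat -> nat -> R) (j k : nat) : R :=
  sum_f_R0 (fun i => PS_mult (a i) (b (j - i)%nat) k) j.

Lemma is_pseries_sum_f_R0 (u : nat -> nat -> R) (y : R) (n : nat) :
  (forall i, (i <= n)%nat -> ex_pseries (u i) y) ->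
  is_pseries (fun k => sum_f_R0 (fun i => u i k) n) y
    (sum_f_R0 (fun i => PSeries (u i) y) n).
Proof.
induction n as [|n IH]; intros H; simpl.
- apply PSeries_correct, H. lia.
- apply (is_pseries_plus (fun k => sum_f_R0 (fun i => u i k) n) (u (S n))).
  + apply IH. intros i Hi. apply H. lia.
  + apply PSeries_correct, H. lia.
Qed.

Lemma PS2_conv (M N r : R) (a b : nat -> nat -> R) (x y : R) :
  0 < r -> geo2 M r a -> geo2 N r b ->
  Rabs x * r <= / 2 -> Rabs y * r <= / 2 ->
  PS2 (conv a b) x y = PS2 a x y * PS2 b x y.
Proof.
intros Hr Ha Hb Hx Hy.
unfold PS2 at 2 3. rewrite <- PSeries_mult.
- apply PSeries_ext. intros j. unfold conv, PS_mult at 2.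
  rewrite (is_pseries_unique _ _ _ (is_pseries_sum_f_R0
     (fun i => PS_mult (a i) (b (j - i)%nat)) y j
     (fun i _ => ex_pseries_mult _ _ _
        (geo1_CV_radius _ _ _ y Hr (geo2_row M r a i Ha) ltac:(lra))
        (geo1_CV_radius _ _ _ y Hr (geo2_row N r b (j - i) Hb) ltac:(lra))))).
  apply sum_eq. intros i _. apply PSeries_mult.
  + apply (geo1_CV_radius _ _ _ y Hr (geo2_row M r a i Ha)); lra.
  + apply (geo1_CV_radius _ _ _ y Hr (geo2_row N r b (j - i) Hb)); lra.
- apply geo1_CV_radius with (2 * M) r; [trivial| |lra]. now apply geo2_geo1.
- apply geo1_CV_radius with (2 * N) r; [trivial| |lra]. now apply geo2_geo1.
Qed.

(* Weights that are submultiplicative for convolution up to a constant. *)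
Definition wt (n : nat) : R := / INR (S n) ^ 2.

Lemma INR_S_pos (n : nat) : 0 < INR (S n).
Proof. apply lt_0_INR. lia. Qed.

Lemma wt_pos (n : nat) : 0 < wt n.
Proof. apply Rinv_0_lt_compat, pow_lt, INR_S_pos. Qed.

Lemma wt_le_1 (n : nat) : wt n <= 1.
Proof.
unfold wt. rewrite <- Rinv_1. apply Rinv_le_contravar; [lra|].
apply pow_R1_Rle. rewrite S_INR. generalize (pos_INR n). lra.
Qed.

(** Telescoping of [1 / (x + 1) ^ 2 <= 1 / x - 1 / (x + 1)]. *)
Lemma sum_wt_le (n : nat) : sum_f_R0 wt n <= 2 - / INR (S n).
Proof.
induction n as [|n IH]; simpl sum_f_R0.
- unfold wt. simpl. lra.
- assert (wt (S n) <= / INR (S n) - / INR (S (S n))); [|lra].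
  unfold wt. rewrite (S_INR (S n)). assert (H := INR_S_pos n).
  set (x := INR (S n)) in *.
  replace (/ x - / (x + 1)) with (/ (x * (x + 1))) by (field; lra).
  apply Rinv_le_contravar; nra.
Qed.

(** With [x = i + 1] and [y = n - i + 1] one has [n + 1 = x + y - 1], and the claim becomes
    [(x + y - 1) ^ 2 <= 2 * (x ^ 2 + y ^ 2)]. *)
Lemma wt_mult_le (n i : nat) : (i <= n)%nat ->
  wt i * wt (n - i) <= 2 * wt n * (wt i + wt (n - i)).
Proof.
intros Hi. unfold wt.
assert (E : INR (S n) = INR (S i) + INR (S (n - i)) - 1).
{ rewrite !S_INR, minus_INR by trivial. ring. }
rewrite E. clear E.
assert (Hx : 1 <= INR (S i)).
{ rewrite S_INR. generalize (pos_INR i). lra. }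
assert (Hy : 1 <= INR (S (n - i))).
{ rewrite S_INR. generalize (pos_INR (n - i)). lra. }
set (x := INR (S i)) in *. set (y := INR (S (n - i))) in *.
replace (2 * / (x + y - 1) ^ 2 * (/ x ^ 2 + / y ^ 2)) with
  ((2 * (x ^ 2 + y ^ 2) / (x + y - 1) ^ 2) * (/ x ^ 2 * / y ^ 2))
  by (field; lra).
rewrite <- (Rmult_1_l (_ * _)) at 1.
apply Rmult_le_compat_r.
- apply Rmult_le_pos; apply Rlt_le, Rinv_0_lt_compat, pow_lt; lra.
- apply Rle_div_r; [apply pow_lt; lra|].
  generalize (pow2_ge_0 (x - y)). nra.
Qed.

(** The product bound splits the sum into two sums of weights, each at most [2]; hence
    [8 = 2 * (2 + 2)]. *)
Lemma wt_conv_le (n : nat) :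
  sum_f_R0 (fun i => wt i * wt (n - i)) n <= 8 * wt n.
Proof.
apply Rle_trans with (sum_f_R0 (fun i => 2 * wt n * (wt i + wt (n - i))) n).
- apply sum_Rle. intros i Hi. now apply wt_mult_le.
- rewrite (sum_eq _ (fun i => (wt i + wt (n - i)) * (2 * wt n))) by (intros; ring).
  rewrite <- scal_sum, plus_sum.
  assert (E : sum_f_R0 (fun i => wt (n - i)) n = sum_f_R0 wt n).
  { rewrite <- !sum_n_Reals. apply sum_n_rev. }
  rewrite E.
  generalize (sum_wt_le n) (wt_pos n) (Rinv_0_lt_compat _ (INR_S_pos n)). nra.
Qed.

Definition wt2 (r : R) (j k : nat) : R := r ^ (j + k) * (wt j * wt k).

(** The constant is [64 = 8 * 8], one factor [8] per variable. Only the rows up to [j] are assumed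
    bounded, since the induction in [ode_coef_bound] knows no others. *)
Lemma conv_wt2_le (A B r : R) (a b : nat -> nat -> R) (j : nat) :
  0 <= r ->
  (forall i k, (i <= j)%nat -> Rabs (a i k) <= A * wt2 r i k) ->
  (forall i k, (i <= j)%nat -> Rabs (b i k) <= B * wt2 r i k) ->
  forall k, Rabs (conv a b j k) <= 64 * A * B * wt2 r j k.
Proof.
intros Hr Ha Hb k. unfold conv, PS_mult.
apply Rle_trans with (sum_f_R0 (fun i => sum_f_R0 (fun l =>
   (wt l * wt (k - l)) * (A * B * r ^ (j + k) * (wt i * wt (j - i)))) k) j).
- rewrite <- !sum_n_Reals. apply Rabs_sum_n_le. intros i Hi.
  rewrite <- !sum_n_Reals. apply Rabs_sum_n_le. intros l Hl.
  rewrite Rabs_mult.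
  apply Rle_trans with (A * wt2 r i l * (B * wt2 r (j - i) (k - l))).
  + apply Rmult_le_compat; try apply Rabs_pos; [apply Ha | apply Hb]; lia.
  + unfold wt2. replace (j + k)%nat with ((i + l) + ((j - i) + (k - l)))%nat by lia.
    rewrite (pow_add r (i + l)). apply Req_le. ring.
- rewrite (sum_eq _ (fun i => (wt i * wt (j - i)) *
    (sum_f_R0 (fun l => wt l * wt (k - l)) k * (A * B * r ^ (j + k))))).
  2: { intros i Hi. rewrite <- scal_sum. ring. }
  rewrite <- scal_sum.
  assert (HA : 0 <= A).
  { generalize (Rabs_pos (a 0%nat 0%nat)) (Ha 0%nat 0%nat ltac:(lia)).
    unfold wt2, wt. simpl. lra. }
  assert (HB : 0 <= B).
  { generalize (Rabs_pos (b 0%nat 0%nat)) (Hb 0%nat 0%nat ltac:(lia)).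
    unfold wt2, wt. simpl. lra. }
  assert (HAB : 0 <= A * B * r ^ (j + k)).
  { apply Rmult_le_pos; [now apply Rmult_le_pos | now apply pow_le]. }
  assert (Hs : forall n, 0 <= sum_f_R0 (fun l => wt l * wt (n - l)) n).
  { intros n. apply cond_pos_sum. intros l.
    apply Rmult_le_pos; apply Rlt_le, wt_pos. }
  apply Rle_trans with (8 * wt k * (A * B * r ^ (j + k)) * (8 * wt j)).
  + apply Rmult_le_compat; [now apply Rmult_le_pos | apply Hs | | apply wt_conv_le].
    apply Rmult_le_compat_r; trivial. apply wt_conv_le.
  + unfold wt2. apply Req_le. ring.
Qed.

(** Polynomials are reified so that values, coefficients and majorants are recursive functions,
    compared by induction on the term. *)
Inductive term : Type :=
| TVar (i : nat)
| TPar (i : nat)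
| TCst (c : R)
| TAdd (e1 e2 : term)
| TMul (e1 e2 : term).

Fixpoint teval (e : term) (y k : nat -> R) : R :=
  match e with
  | TVar i => y i
  | TPar i => k i
  | TCst c => c
  | TAdd e1 e2 => teval e1 y k + teval e2 y k
  | TMul e1 e2 => teval e1 y k * teval e2 y k
  end.

Definition const2 (c : R) (j k : nat) : R :=
  match j, k with O, O => c | _, _ => 0 end.

Fixpoint tcoef (e : term) (y k : nat -> nat -> nat -> R) : nat -> nat -> R :=
  match e with
  | TVar i => y i
  | TPar i => k i
  | TCst c => const2 c
  | TAdd e1 e2 => fun m n => tcoef e1 y k m n + tcoef e2 y k m n
  | TMul e1 e2 => conv (tcoef e1 y k) (tcoef e2 y k)
  end.

(** The majorant does not involve the rate [r], which can therefore still be enlarged once [A] and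
    [B] are fixed. *)
Fixpoint tbound (e : term) (A B : R) : R :=
  match e with
  | TVar i => A
  | TPar i => B
  | TCst c => Rabs c
  | TAdd e1 e2 => tbound e1 A B + tbound e2 A B
  | TMul e1 e2 => 64 * tbound e1 A B * tbound e2 A B
  end.

(** Sums and products never use rows of higher degree in [x]; this triangularity is what lets a
    solution be computed row by row. *)
Lemma tcoef_causal (e : term) (u v k : nat -> nat -> nat -> R) (j : nat) :
  (forall i m n, (m <= j)%nat -> u i m n = v i m n) ->
  forall m n, (m <= j)%nat -> tcoef e u k m n = tcoef e v k m n.
Proof.
intros Huv. induction e as [i|i|c|e1 IH1 e2 IH2|e1 IH1 e2 IH2];
  intros m n Hm; simpl; auto.
- now rewrite IH1, IH2.
- unfold conv, PS_mult. apply sum_eq. intros i Hi.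
  apply sum_eq. intros l Hl. rewrite IH1, IH2; trivial; lia.
Qed.

Lemma wt2_pos (r : R) (j k : nat) : 0 < r -> 0 < wt2 r j k.
Proof.
intros Hr. apply Rmult_lt_0_compat; [now apply pow_lt|].
apply Rmult_lt_0_compat; apply wt_pos.
Qed.

Lemma tcoef_bound (e : term) (u k : nat -> nat -> nat -> R) (A B r : R) (j : nat) :
  0 < r ->
  (forall i m n, (m <= j)%nat -> Rabs (u i m n) <= A * wt2 r m n) ->
  (forall i m n, (m <= j)%nat -> Rabs (k i m n) <= B * wt2 r m n) ->
  forall m n, (m <= j)%nat -> Rabs (tcoef e u k m n) <= tbound e A B * wt2 r m n.
Proof.
intros Hr Hu Hk. induction e as [i|i|c|e1 IH1 e2 IH2|e1 IH1 e2 IH2];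
  intros m n Hm; simpl; auto.
- destruct m as [|m]; [destruct n as [|n]|].
  + unfold const2, wt2, wt. simpl. lra.
  + simpl. rewrite Rabs_R0. apply Rmult_le_pos; [apply Rabs_pos|].
    now apply Rlt_le, wt2_pos.
  + simpl. rewrite Rabs_R0. apply Rmult_le_pos; [apply Rabs_pos|].
    now apply Rlt_le, wt2_pos.
- apply Rle_trans with (1 := Rabs_triang _ _). rewrite Rmult_plus_distr_r.
  apply Rplus_le_compat; auto.
- apply conv_wt2_le; [lra| |]; intros i l Hi; [apply IH1 | apply IH2]; lia.
Qed.

Lemma wt2_geo2 (A r : R) (a : nat -> nat -> R) :
  0 < r -> (forall m n, Rabs (a m n) <= A * wt2 r m n) -> geo2 A r a.
Proof.
intros Hr Ha j k.
assert (HA : 0 <= A).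
{ generalize (Rabs_pos (a 0%nat 0%nat)) (Ha 0%nat 0%nat).
  unfold wt2, wt. simpl. lra. }
apply Rle_trans with (1 := Ha j k). apply Rmult_le_compat_l; trivial.
unfold wt2. rewrite <- (Rmult_1_r (r ^ _)) at 2.
apply Rmult_le_compat_l; [now apply pow_le, Rlt_le|].
rewrite <- (Rmult_1_r 1).
apply Rmult_le_compat; try apply wt_le_1; apply Rlt_le, wt_pos.
Qed.

(** The inverse of a weight satisfies [(l + 1) ^ 2 <= 4 ^ l], so quadrupling the rate pays for
    it. *)
Lemma geo2_wt2 (M r r' : R) (a : nat -> nat -> R) :
  0 < r -> 4 * r <= r' -> geo2 M r a ->
  forall m n, Rabs (a m n) <= M * wt2 r' m n.
Proof.
intros Hr Hr' Ha m n.
assert (HM := geo2_nonneg _ _ _ Ha).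
apply Rle_trans with (1 := Ha m n). apply Rmult_le_compat_l; trivial.
assert (Hp : forall l, r ^ l <= r' ^ l * wt l).
{ intros l. unfold wt. apply Rle_div_r; [apply Rlt_gt, pow_lt, INR_S_pos|].
  apply Rle_trans with ((4 * r) ^ l).
  - rewrite Rpow_mult_distr, Rmult_comm.
    apply Rmult_le_compat_r; [now apply pow_le, Rlt_le|].
    replace 4 with (2 * 2) by ring. rewrite Rpow_mult_distr, <- Rsqr_pow2.
    apply Rmult_le_compat; try apply pos_INR; apply INR_le_pow2.
  - apply pow_incr. lra. }
unfold wt2. rewrite !pow_add.
replace (_ * _ * _) with ((r' ^ m * wt m) * (r' ^ n * wt n)) by ring.
apply Rmult_le_compat; trivial; now apply pow_le, Rlt_le.
Qed.

Lemma geo2_const2 (c r : R) : 0 < r -> geo2 (Rabs c) r (const2 c).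
Proof.
intros Hr j k.
assert (H : 0 <= Rabs c * r ^ (j + k)).
{ apply Rmult_le_pos; [apply Rabs_pos | now apply pow_le, Rlt_le]. }
destruct j as [|j]; [destruct k as [|k]|]; simpl; rewrite ?Rabs_R0; trivial.
lra.
Qed.

Lemma PSeries_only_0 (a : nat -> R) (x : R) :
  (forall n, a (S n) = 0) -> PSeries a x = a 0%nat.
Proof.
intros Ha.
assert (Hx : 0 < Rabs x + 1) by (generalize (Rabs_pos x); lra).
rewrite PSeries_decr_1.
- rewrite (PSeries_ext _ (fun _ => 0)) by exact Ha.
  rewrite PSeries_const_0. ring.
- assert (Hr : 0 < / (Rabs x + 1)) by now apply Rinv_0_lt_compat.
  apply geo1_ex_pseries with (Rabs (a 0%nat)) (/ (Rabs x + 1)); trivial.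
  + intros [|n]; [simpl; lra|]. rewrite Ha, Rabs_R0.
    apply Rmult_le_pos; [apply Rabs_pos | now apply pow_le, Rlt_le].
  + apply Rmult_lt_reg_r with (Rabs x + 1); trivial.
    rewrite Rmult_assoc, Rinv_l; lra.
Qed.

Lemma PS2_const2 (c x y : R) : PS2 (const2 c) x y = c.
Proof.
unfold PS2. rewrite PSeries_only_0.
- now apply PSeries_only_0.
- intros n. apply PSeries_const_0.
Qed.

Lemma PS2_plus (M N r : R) (a b : nat -> nat -> R) (x y : R) :
  0 < r -> geo2 M r a -> geo2 N r b ->
  Rabs x * r <= / 2 -> Rabs y * r <= / 2 ->
  PS2 (fun j k => a j k + b j k) x y = PS2 a x y + PS2 b x y.
Proof.
intros Hr Ha Hb Hx Hy. unfold PS2. rewrite <- PSeries_plus.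
- apply PSeries_ext. intros j. unfold PS_plus at 1.
  change plus with Rplus; simpl.
  apply (PSeries_plus (a j) (b j)).
  + apply geo1_ex_pseries with (2 := geo2_row _ _ _ j Ha); lra.
  + apply geo1_ex_pseries with (2 := geo2_row _ _ _ j Hb); lra.
- apply geo1_ex_pseries with (2 := geo2_geo1 _ _ _ y Hr Ha Hy); lra.
- apply geo1_ex_pseries with (2 := geo2_geo1 _ _ _ y Hr Hb Hy); lra.
Qed.

Lemma PS2_tcoef (e : term) (u k : nat -> nat -> nat -> R) (A B r x y : R) :
  0 < r ->
  (forall i m n, Rabs (u i m n) <= A * wt2 r m n) ->
  (forall i m n, Rabs (k i m n) <= B * wt2 r m n) ->
  Rabs x * r <= / 2 -> Rabs y * r <= / 2 ->
  PS2 (tcoef e u k) x y =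
  teval e (fun i => PS2 (u i) x y) (fun i => PS2 (k i) x y).
Proof.
intros Hr Hu Hk Hx Hy.
assert (Hg : forall e, geo2 (tbound e A B) r (tcoef e u k)).
{ intros e'. apply wt2_geo2; trivial. intros m n.
  apply tcoef_bound with m; auto. }
induction e as [i|i|c|e1 IH1 e2 IH2|e1 IH1 e2 IH2]; simpl; trivial.
- apply PS2_const2.
- rewrite <- IH1, <- IH2.
  exact (PS2_plus _ _ _ _ _ x y Hr (Hg e1) (Hg e2) Hx Hy).
- rewrite <- IH1, <- IH2.
  exact (PS2_conv _ _ _ _ _ x y Hr (Hg e1) (Hg e2) Hx Hy).
Qed.

(** The fuel [n] makes the recursion structural: a row depends on all lower rows of all unknowns, a
    dependence hidden inside [tcoef]. Only the rows below [n] are meaningful. The initial value is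
    constant in the parameter. *)
Fixpoint ode_approx (P : nat -> term) (k : nat -> nat -> nat -> R) (c : nat -> R)
    (n : nat) (i j l : nat) : R :=
  match n with
  | O => 0
  | S n' =>
      match j with
      | O => const2 (c i) 0 l
      | S j' => tcoef (P i) (ode_approx P k c n') k j' l / INR (S j')
      end
  end.

Definition ode_coef (P : nat -> term) (k : nat -> nat -> nat -> R) (c : nat -> R)
    (i j l : nat) : R := ode_approx P k c (S j) i j l.

Lemma ode_approx_stable (P : nat -> term) (k : nat -> nat -> nat -> R) (c : nat -> R)
    (n : nat) :
  forall m i j l, (j < n)%nat -> (n <= m)%nat ->
  ode_approx P k c m i j l = ode_approx P k c n i j l.
Proof.
induction n as [|n IH]; intros m i j l Hj Hm; [lia|].
destruct m as [|m]; [lia|]. simpl. destruct j as [|j]; trivial.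
f_equal. apply tcoef_causal with j; [|lia].
intros i' j' l' Hj'. apply IH; lia.
Qed.

Lemma ode_coef_0 (P : nat -> term) (k : nat -> nat -> nat -> R) (c : nat -> R)
    (i l : nat) : ode_coef P k c i 0 l = const2 (c i) 0 l.
Proof. reflexivity. Qed.

Lemma ode_coef_S (P : nat -> term) (k : nat -> nat -> nat -> R) (c : nat -> R)
    (i j l : nat) :
  ode_coef P k c i (S j) l = tcoef (P i) (ode_coef P k c) k j l / INR (S j).
Proof.
unfold ode_coef at 1.
change (ode_approx P k c (S (S j)) i (S j) l) with
  (tcoef (P i) (ode_approx P k c (S j)) k j l / INR (S j)).
f_equal. apply tcoef_causal with j; [|lia].
intros i' j' l' Hj'. apply ode_approx_stable; lia.
Qed.

(** Induction on the row. Division by [j + 1] compensates the passage from [wt j] to [wt (S j)] up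
    to a factor [4], and the next row allows one more power of [r]; so [4 * K <= A * r] closes the
    induction. *)
Lemma ode_coef_bound (P : nat -> term) (k : nat -> nat -> nat -> R) (c : nat -> R)
    (A B K r : R) :
  0 < A -> 0 < r ->
  (forall i, Rabs (c i) <= A) ->
  (forall i m n, Rabs (k i m n) <= B * wt2 r m n) ->
  (forall i, tbound (P i) A B <= K) -> 4 * K <= A * r ->
  forall i m n, Rabs (ode_coef P k c i m n) <= A * wt2 r m n.
Proof.
intros HA Hr Hc Hk HK HKr.
assert (H : forall j i m n, (m <= j)%nat ->
  Rabs (ode_coef P k c i m n) <= A * wt2 r m n).
{ induction j as [|j IH]; intros i [|m] n Hm; try lia.
  1, 2: rewrite ode_coef_0; destruct n as [|n];
    [unfold wt2, wt; simpl; generalize (Hc i); lra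
    |simpl; rewrite Rabs_R0; apply Rlt_le, Rmult_lt_0_compat; trivial;
     now apply wt2_pos].
  destruct (Nat.eq_dec m j) as [->|Hne]; [|apply IH; lia]. clear Hm.
  rewrite ode_coef_S.
  assert (Hj := INR_S_pos j).
  unfold Rdiv. rewrite Rabs_mult, Rabs_inv, (Rabs_right (INR (S j))) by lra.
  assert (Ht : Rabs (tcoef (P i) (ode_coef P k c) k j n) <= K * wt2 r j n).
  { apply Rle_trans with (tbound (P i) A B * wt2 r j n).
    - apply tcoef_bound with j; auto.
    - apply Rmult_le_compat_r; [now apply Rlt_le, wt2_pos | apply HK]. }
  assert (HK0 : 0 <= K).
  { apply Rmult_le_reg_r with (wt2 r j n); [now apply wt2_pos|].
    rewrite Rmult_0_l. apply Rle_trans with (2 := Ht), Rabs_pos. }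
  assert (Hw : wt j * / INR (S j) <= 4 * wt (S j)).
  { unfold wt. rewrite (S_INR (S j)).
    assert (H1 : 1 <= INR (S j)).
    { rewrite S_INR. generalize (pos_INR j). lra. }
    set (x := INR (S j)) in *.
    rewrite <- Rinv_mult.
    replace (4 * / (x + 1) ^ 2) with (/ ((x + 1) / 2) ^ 2) by (field; lra).
    apply Rinv_le_contravar; [apply pow_lt; lra|].
    apply Rle_trans with (x ^ 2 * 1).
    - rewrite Rmult_1_r. apply pow_incr. lra.
    - apply Rmult_le_compat_l; [apply pow2_ge_0 | lra]. }
  apply Rle_trans with (K * wt2 r j n * / INR (S j)).
  - apply Rmult_le_compat_r; trivial. now apply Rlt_le, Rinv_0_lt_compat.
  - assert (Hp : 0 <= r ^ (j + n) * wt n).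
    { apply Rmult_le_pos; [now apply pow_le, Rlt_le | apply Rlt_le, wt_pos]. }
    unfold wt2. change (S j + n)%nat with (S (j + n)). simpl pow.
    replace (K * _ * _) with
      (K * (r ^ (j + n) * wt n) * (wt j * / INR (S j))) by ring.
    apply Rle_trans with (K * (r ^ (j + n) * wt n) * (4 * wt (S j))).
    + apply Rmult_le_compat_l; trivial. now apply Rmult_le_pos.
    + replace (K * _ * _) with (4 * K * (r ^ (j + n) * wt n * wt (S j))) by ring.
      replace (A * _) with (A * r * (r ^ (j + n) * wt n * wt (S j))) by ring.
      apply Rmult_le_compat_r; trivial.
      apply Rmult_le_pos; trivial. apply Rlt_le, wt_pos. }
intros i m n. apply (H m). lia.
Qed.

Lemma polynomial_ode (P : nat -> term) (k : nat -> nat -> nat -> R) (c : nat -> R)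
    (A B r : R) :
  0 < A -> 0 < r ->
  (forall i, Rabs (c i) <= A) ->
  (forall i, geo2 B r (k i)) ->
  (exists K, forall i, tbound (P i) A B <= K) ->
  exists r', r <= r' /\
    (forall i, geo2 A r' (ode_coef P k c i)) /\
    (forall i y, PS2 (ode_coef P k c i) 0 y = c i) /\
    (forall i x y, Rabs x * r' <= / 2 -> Rabs y * r' <= / 2 ->
      is_derive (fun x => PS2 (ode_coef P k c i) x y) x
        (teval (P i) (fun i => PS2 (ode_coef P k c i) x y) (fun i => PS2 (k i) x y))).
Proof.
intros HA Hr Hc Hk [K HK].
(* [4 * r] turns the geometric bounds on the parameters into weighted ones; [4 * K / A] is what
   [ode_coef_bound] requires. *)
set (r' := Rmax (4 * r) (4 * K / A)).
assert (Hr1 : 4 * r <= r') by apply Rmax_l.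
assert (Hr2 : 4 * K <= A * r').
{ replace (4 * K) with (A * (4 * K / A)) by (field; lra).
  apply Rmult_le_compat_l; [lra | apply Rmax_r]. }
assert (Hr' : 0 < r') by lra.
assert (Hkw : forall i m n, Rabs (k i m n) <= B * wt2 r' m n).
{ intros i. now apply geo2_wt2 with r. }
assert (Huw := ode_coef_bound P k c A B K r' HA Hr' Hc Hkw HK Hr2).
assert (Hu : forall i, geo2 A r' (ode_coef P k c i)).
{ intros i. now apply wt2_geo2. }
exists r'. split; [lra|]. split; [exact Hu|]. split.
- intros i y. unfold PS2. rewrite PSeries_0.
  now rewrite PSeries_only_0.
- intros i x y Hx Hy.
  rewrite <- (PS2_tcoef (P i) (ode_coef P k c) k A B r' x y); trivial.
  replace (tcoef (P i) (ode_coef P k c) k) with (dx (ode_coef P k c i)).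
  + now apply is_derive_PS2_x with A r'.
  + apply functional_extensionality. intros j.
    apply functional_extensionality. intros l.
    unfold dx. rewrite ode_coef_S. field. apply not_0_INR. lia.
Qed.

(** * The trigonometric coefficients *)

Definition trig_coef (m n : nat) : R := (-1) ^ n / INR (fact (2 * n + m)).

(* [Etrig 0 (p^2) = cos p], [Etrig 1 (p^2) = sin p / p],
   [Etrig 2 (p^2) = (1 - cos p) / p^2], [Etrig 3 (p^2) = (p - sin p) / p^3]. *)
Definition Etrig (m : nat) : R -> R := PSeries (trig_coef m).
Definition dEtrig (m : nat) : R -> R := PSeries (PS_derive (trig_coef m)).

Lemma trig_coef_neq_0 (m n : nat) : trig_coef m n <> 0.
Proof.
apply Rmult_integral_contrapositive. split.
- apply pow_nonzero. lra.
- apply Rinv_neq_0_compat, INR_fact_neq_0.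
Qed.

Lemma CV_radius_trig_coef (m : nat) : CV_radius (trig_coef m) = p_infty.
Proof.
apply CV_radius_infinite_DAlembert; [apply trig_coef_neq_0|].
apply is_lim_seq_le_le with (fun _ => 0) (fun n => / INR (S n)).
- intros n. split; [apply Rabs_pos|].
  unfold trig_coef. replace (2 * S n + m)%nat with (S (S (2 * n + m))) by lia.
  rewrite !fact_simpl, !mult_INR.
  assert (Hf : 0 < INR (fact (2 * n + m))) by apply INR_fact_lt_0.
  set (F := INR (fact (2 * n + m))) in *.
  set (x := INR (S (S (2 * n + m)))). set (y := INR (S (2 * n + m))).
  assert (Hy : INR (S n) <= y) by (apply le_INR; lia).
  assert (Hx : 1 <= x) by (apply (le_INR 1); lia).
  assert (Hn : 0 < INR (S n)) by (apply lt_0_INR; lia).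
  assert (Hp : (-1) ^ n <> 0) by (apply pow_nonzero; lra).
  replace (_ / _) with (- / (x * y)) by (simpl; field; repeat split; lra).
  rewrite Rabs_Ropp, Rabs_inv, Rabs_right by nra.
  apply Rinv_le_contravar; nra.
- apply is_lim_seq_const.
- apply (is_lim_seq_incr_1 (fun n => / INR n)).
  replace (Finite 0) with (Rbar_inv p_infty) by reflexivity.
  apply is_lim_seq_inv; [apply is_lim_seq_INR | easy].
Qed.

Lemma ex_pseries_trig_coef (m : nat) (q : R) : ex_pseries (trig_coef m) q.
Proof. apply CV_radius_inside. now rewrite CV_radius_trig_coef. Qed.

Lemma is_derive_Etrig (m : nat) (q : R) : is_derive (Etrig m) q (dEtrig m q).
Proof. apply is_derive_PSeries. now rewrite CV_radius_trig_coef. Qed.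

Lemma Etrig_step (m : nat) (q : R) :
  Etrig m q = / INR (fact m) - q * Etrig (m + 2) q.
Proof.
unfold Etrig. rewrite PSeries_decr_1 by apply ex_pseries_trig_coef.
unfold trig_coef at 1. simpl pow.
replace (2 * 0 + m)%nat with m by lia.
rewrite (PSeries_ext _ (PS_opp (trig_coef (m + 2)))).
- rewrite PSeries_opp. unfold Rdiv. ring.
- intros n. unfold PS_decr_1, PS_opp, trig_coef.
  replace (2 * S n + m)%nat with (2 * n + (m + 2))%nat by lia.
  simpl pow. unfold opp; simpl. field. apply INR_fact_neq_0.
Qed.

Lemma Etrig_0 (m : nat) : Etrig m 0 = / INR (fact m).
Proof. rewrite Etrig_step. ring. Qed.

(** On coefficients this is the factorial recursion. With [q = p ^ 2], and up to a factor [p ^ m],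
    it says that [p ^ (m + 1) * Etrig (S m) q] has derivative [p ^ m * Etrig m q] in [p]. *)
Lemma dEtrig_eq (m : nat) (q : R) :
  2 * (q * dEtrig (S m) q) + INR (S m) * Etrig (S m) q = Etrig m q.
Proof.
unfold dEtrig, Etrig.
rewrite <- PSeries_incr_1, <- !PSeries_scal, <- PSeries_plus.
- apply PSeries_ext. intros n.
  change (2 * PS_incr_1 (PS_derive (trig_coef (S m))) n
    + INR (S m) * trig_coef (S m) n = trig_coef m n).
  destruct n as [|n].
  + change (PS_incr_1 (PS_derive (trig_coef (S m))) 0) with 0.
    rewrite Rmult_0_r, Rplus_0_l.
    unfold trig_coef. simpl pow.
    replace (2 * 0 + S m)%nat with (S m) by lia.
    replace (2 * 0 + m)%nat with m by lia.
    rewrite fact_simpl, mult_INR. field.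
    split; [apply INR_fact_neq_0 | apply not_0_INR; lia].
  + change (PS_incr_1 (PS_derive (trig_coef (S m))) (S n)) with
      (INR (S n) * trig_coef (S m) (S n)).
    unfold trig_coef.
    replace (2 * S n + S m)%nat with (S (2 * S n + m)) by lia.
    rewrite fact_simpl, mult_INR.
    replace (INR (S (2 * S n + m))) with (2 * INR (S n) + INR (S m)).
    * field. split; [apply INR_fact_neq_0|].
      generalize (pos_INR (S n)) (lt_0_INR (S m) ltac:(lia)). lra.
    * rewrite (S_INR (2 * S n + m)), plus_INR, mult_INR, (S_INR m).
      change (INR 2) with (1 + 1). ring.
- apply ex_pseries_scal; [apply Rmult_comm|].
  apply ex_pseries_incr_1, CV_radius_inside.
  now rewrite CV_radius_derive, CV_radius_trig_coef.
- apply ex_pseries_scal; [apply Rmult_comm|]. apply ex_pseries_trig_coef.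
Qed.

Lemma cos_Etrig (x : R) : cos x = Etrig 0 (x ^ 2).
Proof.
unfold cos. destruct (exist_cos (Rsqr x)) as [l Hl].
symmetry. apply is_pseries_unique, is_pseries_R.
rewrite <- Rsqr_pow2.
refine (is_series_ext _ _ _ _ (proj2 (is_series_Reals _ _) Hl)).
intros n. unfold trig_coef, cos_n. now rewrite Nat.add_0_r.
Qed.

Lemma sin_Etrig (x : R) : sin x = x * Etrig 1 (x ^ 2).
Proof.
unfold sin. destruct (exist_sin (Rsqr x)) as [l Hl].
f_equal. symmetry. apply is_pseries_unique, is_pseries_R.
rewrite <- Rsqr_pow2.
exact (proj2 (is_series_Reals _ _) Hl).
Qed.

Lemma Etrig_1_3 (q : R) : Etrig 1 q = 1 - q * Etrig 3 q.
Proof. rewrite Etrig_step. simpl. lra. Qed.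

Lemma Etrig_0_2 (q : R) : Etrig 0 q = 1 - q * Etrig 2 q.
Proof. rewrite Etrig_step. simpl. lra. Qed.

Lemma coef_sin_Etrig (p : R) : coef_sin p = Etrig 1 (p ^ 2).
Proof.
unfold coef_sin. destruct (Req_EM_T p 0) as [->|Hp].
- rewrite pow_i, Etrig_0 by lia. simpl. lra.
- rewrite sin_Etrig. field. trivial.
Qed.

Lemma coef_cos_Etrig (p : R) : coef_cos p = Etrig 2 (p ^ 2).
Proof.
unfold coef_cos. destruct (Req_EM_T p 0) as [->|Hp].
- rewrite pow_i, Etrig_0 by lia. simpl. lra.
- rewrite cos_Etrig, Etrig_0_2. field. trivial.
Qed.

Lemma coef_sub_sin_Etrig (p : R) : coef_sub_sin p = Etrig 3 (p ^ 2).
Proof.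
unfold coef_sub_sin. destruct (Req_EM_T p 0) as [->|Hp].
- rewrite pow_i, Etrig_0 by lia. simpl. lra.
- rewrite sin_Etrig, Etrig_1_3. field. trivial.
Qed.

(** [sin^2 + cos^2 = 1] reads [q * E1 ^ 2 + (1 - q * E2) ^ 2 = 1]; divide by [q], the case [q = 0]
    being an evaluation. *)
Lemma Etrig_pythagoras (q : R) : 0 <= q ->
  Etrig 1 q ^ 2 = 2 * Etrig 2 q - q * Etrig 2 q ^ 2.
Proof.
intros Hq. destruct (Req_dec q 0) as [->|Hq0].
- rewrite !Etrig_0. simpl. field.
- assert (E := sin2_cos2 (sqrt q)). rewrite !Rsqr_pow2 in E.
  rewrite sin_Etrig, cos_Etrig, pow2_sqrt, Etrig_0_2 in E by trivial.
  rewrite Rpow_mult_distr, pow2_sqrt in E by trivial.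
  apply Rmult_eq_reg_l with q; trivial. nra.
Qed.

(** [q * Etrig 2 q] is [1 - cos (sqrt q)], positive until the cosine first returns to [1]. *)
Lemma Etrig_2_pos (q : R) : 0 < q < (2 * PI) ^ 2 -> 0 < Etrig 2 q.
Proof.
intros [Hq0 Hq].
assert (Hs : 0 < sqrt q < 2 * PI).
{ split; [now apply sqrt_lt_R0|].
  rewrite <- (sqrt_pow2 (2 * PI)) by (generalize PI_RGT_0; lra).
  apply sqrt_lt_1_alt. lra. }
assert (Hc : cos (sqrt q) < 1).
{ replace (sqrt q) with (2 * (sqrt q / 2)) by field.
  rewrite cos_2a_sin.
  assert (0 < sin (sqrt q / 2)) by (apply sin_gt_0; lra).
  nra. }
rewrite cos_Etrig, pow2_sqrt, Etrig_0_2 in Hc by lra.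
apply Rmult_lt_reg_l with q; lra.
Qed.

(** * Zero curvature *)

(* The first component of [omega_of]; the others are obtained by rotating the
   coordinates cyclically, and [kappa_of] by taking [f = 0]. *)
Definition frame_x (E1 E2 E3 q a b c f1 f2 f3 u v w : R) : R :=
  f1 + E1 * (b * f3 - c * f2) + E2 * ((a * f1 + b * f2 + c * f3) * a - q * f1)
  + u + E3 * ((a * u + b * v + c * w) * a - q * u) + E2 * (b * w - c * v).

(** [d1], [d2], [d3] stand for the derivatives of [E1], [E2], [E3] with respect to [q], whence the
    factors [q']. [f] counts as constant: [omega_of] is differentiated in [s] only, and [kappa_of]
    has [f = 0]. *)
Definition dframe_x (E1 E2 E3 d1 d2 d3 q a b c f1 f2 f3 u v w
    q' a' b' c' u' v' w' : R) : R :=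
  d1 * q' * (b * f3 - c * f2) + E1 * (b' * f3 - c' * f2)
  + d2 * q' * ((a * f1 + b * f2 + c * f3) * a - q * f1)
  + E2 * ((a' * f1 + b' * f2 + c' * f3) * a
          + (a * f1 + b * f2 + c * f3) * a' - q' * f1)
  + u' + d3 * q' * ((a * u + b * v + c * w) * a - q * u)
  + E3 * ((a' * u + a * u' + b' * v + b * v' + c' * w + c * w') * a
          + (a * u + b * v + c * w) * a' - (q' * u + q * u'))
  + d2 * q' * (b * w - c * v)
  + E2 * (b' * w + b * w' - (c' * v + c * v')).

(** For [q <> 0] the relations express [E3], [d1], [d2], [d3] through [E1], [E2], [q], leaving a
    rational identity modulo one quadratic relation. For [q = 0] this elimination fails, but then
    [a = b = c = 0], which kills every term containing [d1], [d2] or [d3]. *)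
Lemma zero_curvature_x (E1 E2 E3 d1 d2 d3 q a b c f1 f2 f3
    s1 s2 s3 t1 t2 t3 m1 m2 m3 : R) :
  q = a ^ 2 + b ^ 2 + c ^ 2 ->
  E1 = 1 - q * E3 ->
  2 * (q * d1) + E1 = 1 - q * E2 ->
  2 * (q * d2) + 2 * E2 = E1 ->
  2 * (q * d3) + 3 * E3 = E2 ->
  E1 ^ 2 = 2 * E2 - q * E2 ^ 2 ->
  dframe_x E1 E2 E3 d1 d2 d3 q a b c f1 f2 f3 t1 t2 t3
    (2 * (a * s1 + b * s2 + c * s3)) s1 s2 s3 m1 m2 m3
  - dframe_x E1 E2 E3 d1 d2 d3 q a b c 0 0 0 s1 s2 s3
    (2 * (a * t1 + b * t2 + c * t3)) t1 t2 t3 m1 m2 m3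
  + (frame_x E1 E2 E3 q b c a f2 f3 f1 t2 t3 t1
       * frame_x E1 E2 E3 q c a b 0 0 0 s3 s1 s2
     - frame_x E1 E2 E3 q c a b f3 f1 f2 t3 t1 t2
       * frame_x E1 E2 E3 q b c a 0 0 0 s2 s3 s1) = 0.
Proof.
intros Hq H1 Hd1 Hd2 Hd3 Hr.
destruct (Req_dec q 0) as [Hq0|Hq0].
- assert (a = 0) by nra. assert (b = 0) by nra. assert (c = 0) by nra.
  rewrite Hq0 in H1, Hd2. assert (E1 = 1) by lra. assert (E2 = / 2) by lra.
  clear Hq H1 Hd1 Hd2 Hd3 Hr. subst. unfold dframe_x, frame_x. field.
- assert (E3 = (1 - E1) / q).
  { apply Rmult_eq_reg_l with q; trivial.
    transitivity (1 - E1); [lra | now field]. }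
  assert (d1 = ((1 - E1) / q - E2) / 2).
  { apply Rmult_eq_reg_l with q; trivial.
    transitivity ((1 - q * E2 - E1) / 2); [lra | now field]. }
  assert (d2 = (E1 - 2 * E2) / (2 * q)).
  { apply Rmult_eq_reg_l with q; trivial.
    transitivity ((E1 - 2 * E2) / 2); [lra | now field]. }
  assert (d3 = (E2 - 3 * ((1 - E1) / q)) / (2 * q)).
  { apply Rmult_eq_reg_l with q; trivial.
    transitivity ((E2 - 3 * E3) / 2); [lra | subst E3; now field]. }
  (* [E1^2] occurs only in the cross product; its coefficient there is
     [y1 * z2 - z1 * y2]. *)
  set (y1 := c * f1 - a * f3 + (q * t2 - (a * t1 + b * t2 + c * t3) * b) / q).
  set (z1 := a * f2 - b * f1 + (q * t3 - (a * t1 + b * t2 + c * t3) * c) / q).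
  set (y2 := (q * s2 - (a * s1 + b * s2 + c * s3) * b) / q).
  set (z2 := (q * s3 - (a * s1 + b * s2 + c * s3) * c) / q).
  assert (Hc : (y1 * z2 - z1 * y2) * (E1 ^ 2 - (2 * E2 - q * E2 ^ 2)) = 0)
    by (rewrite Hr; ring).
  refine (eq_trans _ Hc). clear Hc H1 Hd1 Hd2 Hd3 Hr. subst E3 d1 d2 d3.
  unfold dframe_x, frame_x, y1, z1, y2, z2. subst q. field. exact Hq0.
Qed.

Definition frame (q : R) : R -> R -> R -> R -> R -> R -> R -> R -> R -> R :=
  frame_x (Etrig 1 q) (Etrig 2 q) (Etrig 3 q) q.

Definition dframe (q : R) :=
  dframe_x (Etrig 1 q) (Etrig 2 q) (Etrig 3 q) (dEtrig 1 q) (dEtrig 2 q) (dEtrig 3 q) q.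

Lemma is_derive_frame_x (e1 e2 e3 q a b c u v w : R -> R)
    (f1 f2 f3 s d1 d2 d3 q' a' b' c' u' v' w' : R) :
  is_derive e1 s (d1 * q') -> is_derive e2 s (d2 * q') -> is_derive e3 s (d3 * q') ->
  is_derive q s q' -> is_derive a s a' -> is_derive b s b' -> is_derive c s c' ->
  is_derive u s u' -> is_derive v s v' -> is_derive w s w' ->
  is_derive (fun s => frame_x (e1 s) (e2 s) (e3 s) (q s) (a s) (b s) (c s)
      f1 f2 f3 (u s) (v s) (w s)) s
    (dframe_x (e1 s) (e2 s) (e3 s) d1 d2 d3 (q s) (a s) (b s) (c s)
      f1 f2 f3 (u s) (v s) (w s) q' a' b' c' u' v' w').
Proof.
intros H1 H2 H3 Hq Ha Hb Hc Hu Hv Hw.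
unfold frame_x. auto_derive.
- repeat match goal with |- _ /\ _ => split end; trivial; eexists; eassumption.
- replace (Derive (fun x => e1 x) s) with (d1 * q') by now symmetry; apply is_derive_unique.
  replace (Derive (fun x => e2 x) s) with (d2 * q') by now symmetry; apply is_derive_unique.
  replace (Derive (fun x => e3 x) s) with (d3 * q') by now symmetry; apply is_derive_unique.
  replace (Derive (fun x => q x) s) with q' by now symmetry; apply is_derive_unique.
  replace (Derive (fun x => a x) s) with a' by now symmetry; apply is_derive_unique.
  replace (Derive (fun x => b x) s) with b' by now symmetry; apply is_derive_unique.
  replace (Derive (fun x => c x) s) with c' by now symmetry; apply is_derive_unique.
  replace (Derive (fun x => u x) s) with u' by now symmetry; apply is_derive_unique.
  replace (Derive (fun x => v x) s) with v' by now symmetry; apply is_derive_unique.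
  replace (Derive (fun x => w x) s) with w' by now symmetry; apply is_derive_unique.
  unfold dframe_x. ring.
Qed.

Lemma is_derive_frame (q a b c u v w : R -> R) (f1 f2 f3 s q' a' b' c' u' v' w' : R) :
  is_derive q s q' -> is_derive a s a' -> is_derive b s b' -> is_derive c s c' ->
  is_derive u s u' -> is_derive v s v' -> is_derive w s w' ->
  is_derive (fun s => frame (q s) (a s) (b s) (c s) f1 f2 f3 (u s) (v s) (w s)) s
    (dframe (q s) (a s) (b s) (c s) f1 f2 f3 (u s) (v s) (w s) q' a' b' c' u' v' w').
Proof.
intros Hq Ha Hb Hc Hu Hv Hw.
assert (HE : forall m, is_derive (fun s => Etrig m (q s)) s (dEtrig m (q s) * q')).
{ intros m. rewrite Rmult_comm.
  apply (is_derive_comp (Etrig m) q); trivial. apply is_derive_Etrig. }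
now apply (is_derive_frame_x (fun s => Etrig 1 (q s)) (fun s => Etrig 2 (q s))
  (fun s => Etrig 3 (q s)) q a b c u v w).
Qed.

Lemma enorm_sqr (v : R3) : enorm v ^ 2 = dot v v.
Proof. unfold enorm. apply pow2_sqrt. unfold dot. nra. Qed.

Definition frame3 (P F T : R3) : R3 :=
  (frame (dot P P) (vec_x P) (vec_y P) (vec_z P) (vec_x F) (vec_y F) (vec_z F)
     (vec_x T) (vec_y T) (vec_z T),
   frame (dot P P) (vec_y P) (vec_z P) (vec_x P) (vec_y F) (vec_z F) (vec_x F)
     (vec_y T) (vec_z T) (vec_x T),
   frame (dot P P) (vec_z P) (vec_x P) (vec_y P) (vec_z F) (vec_x F) (vec_y F)
     (vec_z T) (vec_x T) (vec_y T)).

Definition dframe3 (P F T P' T' : R3) : R3 :=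
  (dframe (dot P P) (vec_x P) (vec_y P) (vec_z P) (vec_x F) (vec_y F) (vec_z F)
     (vec_x T) (vec_y T) (vec_z T) (2 * dot P P')
     (vec_x P') (vec_y P') (vec_z P') (vec_x T') (vec_y T') (vec_z T'),
   dframe (dot P P) (vec_y P) (vec_z P) (vec_x P) (vec_y F) (vec_z F) (vec_x F)
     (vec_y T) (vec_z T) (vec_x T) (2 * dot P P')
     (vec_y P') (vec_z P') (vec_x P') (vec_y T') (vec_z T') (vec_x T'),
   dframe (dot P P) (vec_z P) (vec_x P) (vec_y P) (vec_z F) (vec_x F) (vec_y F)
     (vec_z T) (vec_x T) (vec_y T) (2 * dot P P')
     (vec_z P') (vec_x P') (vec_y P') (vec_z T') (vec_x T') (vec_y T')).

Ltac solve_R3 :=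
  repeat apply injective_projections;
  repeat (unfold frame_x, cross, dot, vec_x, vec_y, vec_z, plus, minus, opp, scal, mult;
    simpl); change_R; ring.

Lemma omega_of_frame (p : R -> R -> R3) (f : R -> R3) (s t : R) :
  omega_of p f s t = frame3 (p s t) (f t) (d_t p s t).
Proof.
unfold omega_of, frame3.
rewrite coef_sin_Etrig, coef_cos_Etrig, coef_sub_sin_Etrig, enorm_sqr.
generalize (p s t) (f t) (d_t p s t). intros P F T. unfold frame.
generalize (Etrig 1 (dot P P)) (Etrig 2 (dot P P)) (Etrig 3 (dot P P)).
destruct P as [[a b] c], F as [[f1 f2] f3], T as [[t1 t2] t3].
intros e1 e2 e3. solve_R3.
Qed.

Lemma kappa_of_frame (p : R -> R -> R3) (s t : R) :
  kappa_of p s t = frame3 (p s t) (0, 0, 0) (d_s p s t).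
Proof.
unfold kappa_of, frame3.
rewrite coef_cos_Etrig, coef_sub_sin_Etrig, enorm_sqr.
generalize (p s t) (d_s p s t). intros P S. unfold frame.
generalize (Etrig 1 (dot P P)) (Etrig 2 (dot P P)) (Etrig 3 (dot P P)).
destruct P as [[a b] c], S as [[s1 s2] s3].
intros e1 e2 e3. solve_R3.
Qed.

(** * Vector-valued derivatives and the solution property *)

Lemma ex_derive_R3 (f : R -> R3) (x : R) :
  ex_derive (fun u => vec_x (f u)) x -> ex_derive (fun u => vec_y (f u)) x ->
  ex_derive (fun u => vec_z (f u)) x -> ex_derive f x.
Proof.
intros Hx Hy Hz.
(* Written on a fixed basis, the map becomes a sum of real functions times constant vectors, to
   which the general rules apply. *)
apply ex_derive_ext with (fun u => plus (plus
  (scal (vec_x (f u)) ((1, 0, 0) : R3)) (scal (vec_y (f u)) ((0, 1, 0) : R3)))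
  (scal (vec_z (f u)) ((0, 0, 1) : R3))).
- intros u. apply injective_projections; [apply injective_projections|]; simpl;
  unfold plus, scal; simpl; unfold mult, vec_x, vec_y, vec_z; simpl; ring.
- apply @ex_derive_plus; [apply @ex_derive_plus|]; now apply @ex_derive_scal_l.
Qed.

Definition is_derive3 (f : R -> R3) (x : R) (l : R3) : Prop :=
  forall c, coordinate c -> is_derive (fun u => c (f u)) x (c l).

Lemma is_derive3_coordinates (f : R -> R3) (x : R) (l : R3) :
  is_derive (fun u => vec_x (f u)) x (vec_x l) ->
  is_derive (fun u => vec_y (f u)) x (vec_y l) ->
  is_derive (fun u => vec_z (f u)) x (vec_z l) -> is_derive3 f x l.
Proof. now intros Hx Hy Hz c [-> | [-> | ->]]. Qed.

Lemma is_derive3_x (f : R -> R3) (x : R) (l : R3) :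
  is_derive3 f x l -> is_derive (fun u => vec_x (f u)) x (vec_x l).
Proof. intros H. apply (H vec_x). now left. Qed.

Lemma is_derive3_y (f : R -> R3) (x : R) (l : R3) :
  is_derive3 f x l -> is_derive (fun u => vec_y (f u)) x (vec_y l).
Proof. intros H. apply (H vec_y). now right; left. Qed.

Lemma is_derive3_z (f : R -> R3) (x : R) (l : R3) :
  is_derive3 f x l -> is_derive (fun u => vec_z (f u)) x (vec_z l).
Proof. intros H. apply (H vec_z). now right; right. Qed.

Lemma is_derive3_ex_derive (f : R -> R3) (x : R) (l : R3) :
  is_derive3 f x l -> ex_derive f x.
Proof.
intros H. apply ex_derive_R3; eexists.
- exact (is_derive3_x _ _ _ H).
- exact (is_derive3_y _ _ _ H).
- exact (is_derive3_z _ _ _ H).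
Qed.

Lemma is_derive3_unique (f : R -> R3) (x : R) (l : R3) :
  is_derive3 f x l -> Derive3 f x = l.
Proof.
intros H. destruct l as [[a b] c]. unfold Derive3. repeat apply f_equal2.
- now apply is_derive_unique, (is_derive3_x f x (a, b, c)).
- now apply is_derive_unique, (is_derive3_y f x (a, b, c)).
- now apply is_derive_unique, (is_derive3_z f x (a, b, c)).
Qed.

Lemma is_derive_dot (P Q : R -> R3) (x : R) (P' Q' : R3) :
  is_derive3 P x P' -> is_derive3 Q x Q' ->
  is_derive (fun u => dot (P u) (Q u)) x (dot P' (Q x) + dot (P x) Q').
Proof.
intros HP HQ.
assert (H : forall a b : R -> R, forall a' b', is_derive a x a' -> is_derive b x b' ->
  is_derive (fun u => a u * b u) x (a' * b x + a x * b')).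
{ intros a b a' b' Ha Hb. auto_derive.
  - split; [|split]; trivial; eexists; eassumption.
  - replace (Derive (fun x => a x) x) with a' by now symmetry; apply is_derive_unique.
    replace (Derive (fun x => b x) x) with b' by now symmetry; apply is_derive_unique.
    ring. }
unfold dot.
replace (_ + _) with
  ((vec_x P' * vec_x (Q x) + vec_x (P x) * vec_x Q')
   + (vec_y P' * vec_y (Q x) + vec_y (P x) * vec_y Q')
   + (vec_z P' * vec_z (Q x) + vec_z (P x) * vec_z Q')) by ring.
apply @is_derive_plus; [apply @is_derive_plus|].
- apply H; now apply is_derive3_x.
- apply H; now apply is_derive3_y.
- apply H; now apply is_derive3_z.
Qed.

Lemma is_derive3_frame3 (P T : R -> R3) (F : R3) (x : R) (P' T' : R3) :
  is_derive3 P x P' -> is_derive3 T x T' ->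
  is_derive3 (fun u => frame3 (P u) F (T u)) x (dframe3 (P x) F (T x) P' T').
Proof.
intros HP HT.
assert (HQ : is_derive (fun u => dot (P u) (P u)) x (2 * dot (P x) P')).
{ replace (2 * dot (P x) P') with (dot P' (P x) + dot (P x) P').
  - now apply is_derive_dot.
  - unfold dot. ring. }
assert (Px := is_derive3_x _ _ _ HP). assert (Py := is_derive3_y _ _ _ HP).
assert (Pz := is_derive3_z _ _ _ HP). assert (Tx := is_derive3_x _ _ _ HT).
assert (Ty := is_derive3_y _ _ _ HT). assert (Tz := is_derive3_z _ _ _ HT).
apply is_derive3_coordinates.
- exact (is_derive_frame _ _ _ _ _ _ _ _ _ _ _ _ _ _ _ _ _ _ HQ Px Py Pz Tx Ty Tz).
- exact (is_derive_frame _ _ _ _ _ _ _ _ _ _ _ _ _ _ _ _ _ _ HQ Py Pz Px Ty Tz Tx).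
- exact (is_derive_frame _ _ _ _ _ _ _ _ _ _ _ _ _ _ _ _ _ _ HQ Pz Px Py Tz Tx Ty).
Qed.

Lemma zero_curvature (q a b c f1 f2 f3 s1 s2 s3 t1 t2 t3 m1 m2 m3 : R) :
  q = a ^ 2 + b ^ 2 + c ^ 2 ->
  dframe q a b c f1 f2 f3 t1 t2 t3 (2 * (a * s1 + b * s2 + c * s3)) s1 s2 s3 m1 m2 m3
  - dframe q a b c 0 0 0 s1 s2 s3 (2 * (a * t1 + b * t2 + c * t3)) t1 t2 t3 m1 m2 m3
  + (frame q b c a f2 f3 f1 t2 t3 t1 * frame q c a b 0 0 0 s3 s1 s2
     - frame q c a b f3 f1 f2 t3 t1 t2 * frame q b c a 0 0 0 s2 s3 s1) = 0.
Proof.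
intros Hq.
assert (H1 := dEtrig_eq 0 q). assert (H2 := dEtrig_eq 1 q).
assert (H3 := dEtrig_eq 2 q). rewrite Etrig_0_2 in H1. simpl in H1, H2, H3.
apply zero_curvature_x; trivial; try lra.
- apply Etrig_1_3.
- apply Etrig_pythagoras. rewrite Hq. nra.
Qed.

Lemma zero_curvature3 (P F S T M : R3) :
  plus (minus (dframe3 P F T S M) (dframe3 P (0, 0, 0) S T M))
    (cross (frame3 P F T) (frame3 P (0, 0, 0) S)) = zero.
Proof.
destruct P as [[a b] c], F as [[f1 f2] f3], S as [[s1 s2] s3],
  T as [[t1 t2] t3], M as [[m1 m2] m3].
unfold dframe3, frame3, cross, dot, vec_x, vec_y, vec_z. simpl fst. simpl snd.
set (q := a * a + b * b + c * c).
repeat apply injective_projections; simpl fst; simpl snd.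
- assert (Hq : q = a ^ 2 + b ^ 2 + c ^ 2) by (unfold q; ring).
  exact (zero_curvature q a b c f1 f2 f3 s1 s2 s3 t1 t2 t3 m1 m2 m3 Hq).
- assert (Hq : q = b ^ 2 + c ^ 2 + a ^ 2) by (unfold q; ring).
  refine (eq_trans _
    (zero_curvature q b c a f2 f3 f1 s2 s3 s1 t2 t3 t1 m2 m3 m1 Hq)).
  replace (a * s1 + b * s2 + c * s3) with (b * s2 + c * s3 + a * s1) by ring.
  replace (a * t1 + b * t2 + c * t3) with (b * t2 + c * t3 + a * t1) by ring.
  reflexivity.
- assert (Hq : q = c ^ 2 + a ^ 2 + b ^ 2) by (unfold q; ring).
  refine (eq_trans _
    (zero_curvature q c a b f3 f1 f2 s3 s1 s2 t3 t1 t2 m3 m1 m2 Hq)).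
  replace (a * s1 + b * s2 + c * s3) with (c * s3 + a * s1 + b * s2) by ring.
  replace (a * t1 + b * t2 + c * t3) with (c * t3 + a * t1 + b * t2) by ring.
  reflexivity.
Qed.

(** A single [M] serves for both orders of differentiation; it cancels in the curvature. *)
Definition twice_derivable (p : R -> R -> R3) (s t : R) : Prop :=
  exists S T M : R3,
    is_derive3 (fun s' => p s' t) s S /\ is_derive3 (fun t' => p s t') t T /\
    is_derive3 (fun s' => d_t p s' t) s M /\ is_derive3 (fun t' => d_s p s t') t M.

Lemma solution_of_twice_derivable (p : R -> R -> R3) (f : R -> R3) (s t : R) :
  twice_derivable p s t ->
  exists O K : R3,
    is_derive3 (fun s' => omega_of p f s' t) s O /\
    is_derive3 (fun t' => kappa_of p s t') t K /\
    plus (minus O K) (cross (omega_of p f s t) (kappa_of p s t)) = zero.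
Proof.
intros (S & T & M & HS & HT & HTS & HST).
exists (dframe3 (p s t) (f t) (d_t p s t) S M),
  (dframe3 (p s t) (0, 0, 0) (d_s p s t) T M).
split; [|split].
- intros c Hc. apply is_derive_ext with (fun s' => c (frame3 (p s' t) (f t) (d_t p s' t))).
  + intros s'. now rewrite omega_of_frame.
  + revert c Hc. exact (is_derive3_frame3 _ _ (f t) s S M HS HTS).
- intros c Hc. apply is_derive_ext with (fun t' => c (frame3 (p s t') (0, 0, 0) (d_s p s t'))).
  + intros t'. now rewrite kappa_of_frame.
  + revert c Hc. exact (is_derive3_frame3 _ _ (0, 0, 0) t T M HT HST).
- rewrite omega_of_frame, kappa_of_frame.
  replace (d_s p s t) with S by (symmetry; now apply is_derive3_unique).
  replace (d_t p s t) with T by (symmetry; now apply is_derive3_unique).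
  apply zero_curvature3.
Qed.

Lemma rep2_dx (f : R -> R -> R) (x0 y0 M r : R) (a : nat -> nat -> R) :
  rep2 f x0 y0 M r a ->
  (forall x y, Rabs (x - x0) * (4 * r) <= / 2 -> Rabs (y - y0) * (4 * r) <= / 2 ->
     is_derive (fun x => f x y) x (PS2 (dx a) (x - x0) (y - y0))) /\
  rep2 (fun x y => Derive (fun x => f x y) x) x0 y0 (M * r) (4 * r) (dx a).
Proof.
intros (Hr & Ha & Hf).
assert (H : forall x y, Rabs (x - x0) * (4 * r) <= / 2 ->
  Rabs (y - y0) * (4 * r) <= / 2 ->
  is_derive (fun x => f x y) x (PS2 (dx a) (x - x0) (y - y0))).
{ intros x y Hx Hy.
  apply is_derive_ext_loc with (fun x => PS2 a (x - x0) (y - y0)).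
  - assert (Hc : continuous (fun z => z - x0) x)
      by (apply @ex_derive_continuous; now auto_derive).
    assert (Hx' : Rabs (x - x0) * r < / 2) by lra.
    assert (Hl : locally x (fun z => Rabs (z - x0) * r < / 2))
      by exact (Hc _ (locally_Rabs_mult_lt _ _ _ Hx')).
    revert Hl. apply filter_imp. intros z Hz. symmetry. apply Hf; lra.
  - replace (PS2 (dx a) (x - x0) (y - y0)) with
      (scal 1 (PS2 (dx a) (x - x0) (y - y0))) by apply Rmult_1_l.
    apply (is_derive_comp (fun x => PS2 a x (y - y0)) (fun x => x - x0)).
    + apply is_derive_PS2_x with M r; trivial; lra.
    + auto_derive; trivial; ring. }
split; [exact H|]. split; [lra|]. split.
- assert (HM := geo2_nonneg _ _ _ Ha).
  apply geo2_weaken with (M * r) (2 * r); try lra. now apply geo2_dx.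
- intros x y Hx Hy. now apply is_derive_unique, H.
Qed.

Lemma rep2_swap (f : R -> R -> R) (x0 y0 M r : R) (a : nat -> nat -> R) :
  rep2 f x0 y0 M r a -> rep2 (fun y x => f x y) y0 x0 M r (fun k j => a j k).
Proof.
intros (Hr & Ha & Hf). split; [trivial|]. split.
- intros j k. rewrite Nat.add_comm. apply Ha.
- intros y x Hy Hx. rewrite Hf by trivial. now apply PS2_swap with M r.
Qed.

(** At the centre both mixed derivatives reduce to the coefficient [a 1 1], which is why they
    agree. *)
Lemma rep2_mixed (f : R -> R -> R) (x0 y0 M r : R) (a : nat -> nat -> R) :
  rep2 f x0 y0 M r a ->
  ex_derive (fun x => f x y0) x0 /\ ex_derive (fun y => f x0 y) y0 /\
  exists m, is_derive (fun x => Derive (fun y => f x y) y0) x0 m /\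
    is_derive (fun y => Derive (fun x => f x y) x0) y0 m.
Proof.
intros Hf.
assert (H0 : forall z c, Rabs (z - z) * c <= / 2).
{ intros z c. rewrite Rminus_eq_0, Rabs_R0. lra. }
destruct (rep2_dx _ _ _ _ _ _ Hf) as [Hx Rx].
destruct (rep2_dx _ _ _ _ _ _ (rep2_swap _ _ _ _ _ _ Hf)) as [Hy Ry].
split; [eexists; now apply Hx|]. split; [eexists; now apply Hy|].
destruct (rep2_dx _ _ _ _ _ _ (rep2_swap _ _ _ _ _ _ Rx)) as [Hxy _].
destruct (rep2_dx _ _ _ _ _ _ (rep2_swap _ _ _ _ _ _ Ry)) as [Hyx _].
exists (PS2 (dx (dy a)) (x0 - x0) (y0 - y0)). split.
- exact (Hyx x0 y0 (H0 _ _) (H0 _ _)).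
- replace (PS2 (dx (dy a)) (x0 - x0) (y0 - y0)) with
    (PS2 (dx (fun k j => dx a j k)) (y0 - y0) (x0 - x0)).
  + exact (Hxy y0 x0 (H0 _ _) (H0 _ _)).
  + rewrite !Rminus_eq_0. unfold PS2. rewrite !PSeries_0.
    unfold dx, dy. ring.
Qed.

Lemma analytic2_at_twice_derivable (p : R -> R -> R3) (s t : R) :
  analytic2_at p s t -> twice_derivable p s t.
Proof.
intros Hp.
assert (H : forall c, coordinate c ->
  ex_derive (fun s' => c (p s' t)) s /\ ex_derive (fun t' => c (p s t')) t /\
  exists m, is_derive (fun s' => Derive (fun t' => c (p s' t')) t) s m /\
    is_derive (fun t' => Derive (fun s' => c (p s' t')) s) t m).
{ intros c Hc. destruct (analytic2_at_rep2 p s t c Hc Hp) as (M & r & a & Ha).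
  exact (rep2_mixed _ _ _ _ _ _ Ha). }
destruct (H vec_x (or_introl eq_refl)) as ([s1 S1] & [t1 T1] & m1 & MS1 & MT1).
destruct (H vec_y (or_intror (or_introl eq_refl)))
  as ([s2 S2] & [t2 T2] & m2 & MS2 & MT2).
destruct (H vec_z (or_intror (or_intror eq_refl)))
  as ([s3 S3] & [t3 T3] & m3 & MS3 & MT3).
exists (s1, s2, s3), (t1, t2, t3), (m1, m2, m3).
split; [|split; [|split]]; apply is_derive3_coordinates; assumption.
Qed.

Lemma omega_kappa_solution (D : R * R -> Prop) (p : R -> R -> R3) (f : R -> R3) :
  analytic2_on D p -> is_solution D (omega_of p f) (kappa_of p).
Proof.
intros Hp s t Hst.
destruct (solution_of_twice_derivable p f s t) as (O & K & HO & HK & HOK).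
- now apply analytic2_at_twice_derivable, Hp.
- split; [now apply is_derive3_ex_derive with O|].
  split; [now apply is_derive3_ex_derive with K|].
  replace (d_s (omega_of p f) s t) with O by (symmetry; now apply is_derive3_unique).
  replace (d_t (kappa_of p) s t) with K by (symmetry; now apply is_derive3_unique).
  exact HOK.
Qed.

(** * Uniqueness for linear equations on an interval *)

Lemma Rabs_lt_locally (x0 eta x : R) :
  Rabs (x - x0) < eta -> locally x (fun z => Rabs (z - x0) < eta).
Proof.
intros Hx.
assert (Hc : continuous (fun z => Rabs (z - x0)) x).
{ apply (continuous_comp (fun z => z - x0) Rabs); [|apply continuous_Rabs].
  apply @ex_derive_continuous. now auto_derive. }
exact (Hc (fun v => v < eta) (open_lt eta _ Hx)).
Qed.

Lemma Rabs_between (s0 eta s z : R) :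
  Rabs (s - s0) < eta -> Rmin s0 s <= z <= Rmax s0 s -> Rabs (z - s0) < eta.
Proof.
intros Hs. unfold Rmin, Rmax. destruct (Rle_dec s0 s) as [Hle|Hle]; intros Hz.
- rewrite Rabs_right in Hs |- *; lra.
- rewrite Rabs_left1 in Hs |- *; lra.
Qed.

Lemma constant_on_interval (h : R -> R) (s0 eta : R) :
  (forall s, Rabs (s - s0) < eta -> is_derive h s 0) ->
  forall s, Rabs (s - s0) < eta -> h s = h s0.
Proof.
intros Hh s Hs.
assert (Hin := fun z => Rabs_between s0 eta s z Hs).
destruct (MVT_gen h s0 s (fun _ => 0)) as [z [_ Hz]].
- intros z Hz. apply Hh, Hin. lra.
- intros z Hz. apply continuity_pt_filterlim, (@ex_derive_continuous R_AbsRing R_NormedModule).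
  eexists. now apply Hh, Hin.
- lra.
Qed.

(** Integrating factor: [h * exp (- L)] is constant for a primitive [L] of [l]. This is how
    relations between the unknowns persist along the flow. *)
Lemma linear_ode_zero (h l : R -> R) (s0 eta : R) :
  (forall s, Rabs (s - s0) < eta -> is_derive h s (l s * h s)) ->
  (forall s, Rabs (s - s0) < eta -> continuous l s) ->
  h s0 = 0 -> forall s, Rabs (s - s0) < eta -> h s = 0.
Proof.
intros Hh Hl H0 s Hs.
set (L := fun s => RInt l s0 s).
assert (HL : forall z, Rabs (z - s0) < eta -> is_derive L z (l z)).
{ intros z Hz. apply (is_derive_RInt l L s0 z); [|now apply Hl].
  generalize (Rabs_lt_locally _ _ _ Hz). apply filter_imp. intros y Hy. apply (@RInt_correct R_CompleteNormedModule).
  apply (@ex_RInt_continuous R_CompleteNormedModule). intros x Hx.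
  now apply Hl, Rabs_between with y. }
assert (Hv : h s * exp (- L s) = h s0 * exp (- L s0)).
{ apply (constant_on_interval (fun s => h s * exp (- L s)) s0 eta); trivial.
  intros z Hz. generalize (HL z Hz) (Hh z Hz). generalize L. clear. intros L HL Hh.
  auto_derive.
  - split; [eexists; eassumption|]. split; [eexists; eassumption | trivial].
  - replace (Derive (fun x => L x) z) with (l z) by now symmetry; apply is_derive_unique.
    replace (Derive (fun x => h x) z) with (l z * h z)
      by now symmetry; apply is_derive_unique.
    ring. }
rewrite H0, Rmult_0_l in Hv.
apply Rmult_integral in Hv. destruct Hv as [Hv|Hv]; trivial.
generalize (exp_pos (- L s)). lra.
Qed.

(** * Generality *)

(** A coordinate of [K - A K / 2 + g A^2 K], where [A] is the skew matrix of [P]. *)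
Definition lift_x (g a b c k1 k2 k3 : R) : R :=
  k1 + - / 2 * (b * k3 - c * k2)
  + g * (a * (a * k1 + b * k2 + c * k3) - (a ^ 2 + b ^ 2 + c ^ 2) * k1).

(* The inverse of the linear map [frame3 P 0] for
   [g = (1 - (p/2) cot (p/2)) / p^2], where [p = |P|]. *)
Definition lift3 (g : R) (P K : R3) : R3 :=
  (lift_x g (vec_x P) (vec_y P) (vec_z P) (vec_x K) (vec_y K) (vec_z K),
   lift_x g (vec_y P) (vec_z P) (vec_x P) (vec_y K) (vec_z K) (vec_x K),
   lift_x g (vec_z P) (vec_x P) (vec_y P) (vec_z K) (vec_x K) (vec_y K)).

(** The corrections added to [K] are orthogonal to [P]. Hence along the flow [q] has derivative
    [2 * dot P K], free of [g]. *)
Lemma dot_lift3 (g : R) (P K : R3) : dot P (lift3 g P K) = dot P K.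
Proof.
destruct P as [[a b] c], K as [[k1 k2] k3].
unfold dot, lift3, lift_x, vec_x, vec_y, vec_z. simpl. field.
Qed.

(** The product [(1 + E2 A + E3 A^2) (1 - A / 2 + g A^2)] is reduced by [A^3 = - q A]; the last two
    hypotheses say that its coefficients of [A] and [A^2] vanish. *)
Lemma frame_x_lift (E1 E2 E3 g q a b c k1 k2 k3 : R) :
  q = a ^ 2 + b ^ 2 + c ^ 2 ->
  E2 - / 2 - q * E2 * g + / 2 * (q * E3) = 0 ->
  E3 + g - / 2 * E2 - q * E3 * g = 0 ->
  frame_x E1 E2 E3 q a b c 0 0 0 (lift_x g a b c k1 k2 k3)
    (lift_x g b c a k2 k3 k1) (lift_x g c a b k3 k1 k2) = k1.
Proof.
intros Hq H1 H2.
apply Rminus_diag_uniq.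
transitivity ((E2 - / 2 - q * E2 * g + / 2 * (q * E3)) * (b * k3 - c * k2)
  + (E3 + g - / 2 * E2 - q * E3 * g)
    * (a * (a * k1 + b * k2 + c * k3) - (a ^ 2 + b ^ 2 + c ^ 2) * k1)).
- rewrite Hq. unfold frame_x, lift_x. field.
- rewrite H1, H2. ring.
Qed.

Lemma frame3_lift3 (g : R) (P K : R3) :
  0 < dot P P -> 0 < Etrig 2 (dot P P) ->
  dot P P * Etrig 2 (dot P P) * g - Etrig 2 (dot P P) + / 2 * Etrig 1 (dot P P) = 0 ->
  frame3 P (0, 0, 0) (lift3 g P K) = K.
Proof.
intros Hq HE2 Hg.
assert (E13 := Etrig_1_3 (dot P P)).
assert (Epy := Etrig_pythagoras (dot P P) (Rlt_le _ _ Hq)).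
assert (H1 : Etrig 2 (dot P P) - / 2 - dot P P * Etrig 2 (dot P P) * g
   + / 2 * (dot P P * Etrig 3 (dot P P)) = 0) by lra.
assert (H2 : Etrig 3 (dot P P) + g - / 2 * Etrig 2 (dot P P)
   - dot P P * Etrig 3 (dot P P) * g = 0).
{ clear H1. revert Hq HE2 Hg E13 Epy.
  generalize (dot P P) (Etrig 1 (dot P P)) (Etrig 2 (dot P P)) (Etrig 3 (dot P P)).
  intros q E1 E2 E3 Hq HE2 Hg E13 Epy.
  (* The condition on [A] is the hypothesis on [g] rewritten. The one on [A^2] follows from it after
     multiplication by [q * E2], thanks to the Pythagorean relation. *)
  apply Rmult_eq_reg_l with (q * E2); [|nra]. rewrite Rmult_0_r.
  replace (q * E2 * _) with
    (E2 * (q * E3) + (q * E2 * g) * (1 - q * E3) - / 2 * (q * E2 ^ 2)) by ring.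
  replace (q * E3) with (1 - E1) by lra.
  replace (q * E2 * g) with (E2 - / 2 * E1) by lra.
  replace (q * E2 ^ 2) with (2 * E2 - E1 ^ 2) by lra. field. }
destruct P as [[a b] c], K as [[k1 k2] k3].
unfold frame3, lift3, frame. simpl vec_x in *. simpl vec_y in *. simpl vec_z in *.
repeat apply f_equal2; apply frame_x_lift; trivial;
unfold dot, vec_x, vec_y, vec_z; simpl; ring.
Qed.

(* For [q = p^2] it vanishes when [g = (1 - (p/2) cot (p/2)) / p^2]; clearing the
   denominator avoids the cotangent. *)
Definition kernel_coef_residue (q g : R) : R :=
  q * Etrig 2 q * g - Etrig 2 q + / 2 * Etrig 1 q.

(** The Riccati equation assumed for [g] makes the residue a solution of a linear homogeneous
    equation; the two sides differ by a multiple of the Pythagorean relation. *)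
Lemma is_derive_kernel_coef_residue (q g : R -> R) (s m d : R) :
  0 < q s -> 0 < Etrig 2 (q s) -> m * q s = 1 ->
  is_derive q s (2 * d) ->
  is_derive g s ((/ 4 * m - 3 * (g s * m) + g s ^ 2) * d) ->
  is_derive (fun s => kernel_coef_residue (q s) (g s)) s
    (d * (g s - 2 * m + m * Etrig 1 (q s) / (2 * Etrig 2 (q s)))
      * kernel_coef_residue (q s) (g s)).
Proof.
intros Hq HE2 Hm Dq Dg.
assert (HE : forall m, is_derive (fun s => Etrig m (q s)) s (dEtrig m (q s) * (2 * d))).
{ intros n. rewrite Rmult_comm.
  apply (is_derive_comp (Etrig n) q); trivial. apply is_derive_Etrig. }
unfold kernel_coef_residue.
assert (H1 := dEtrig_eq 0 (q s)). assert (H2 := dEtrig_eq 1 (q s)).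
rewrite Etrig_0_2 in H1. simpl in H1, H2.
assert (E13 := Etrig_1_3 (q s)).
assert (Epy := Etrig_pythagoras (q s) (Rlt_le _ _ Hq)).
set (e1 := fun s : R => Etrig 1 (q s)). set (e2 := fun s : R => Etrig 2 (q s)).
assert (D1 : is_derive e1 s (dEtrig 1 (q s) * (2 * d))) by apply HE.
assert (D2 : is_derive e2 s (dEtrig 2 (q s) * (2 * d))) by apply HE.
clear HE.
change (Etrig 1 (q s)) with (e1 s) in *. change (Etrig 2 (q s)) with (e2 s) in *.
change (is_derive (fun s => q s * e2 s * g s - e2 s + / 2 * e1 s) s
  (d * (g s - 2 * m + m * e1 s / (2 * e2 s))
    * (q s * e2 s * g s - e2 s + / 2 * e1 s))).
clearbody e1 e2. revert H1 H2 E13 D1 D2.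
generalize (Etrig 3 (q s)) (dEtrig 1 (q s)) (dEtrig 2 (q s)).
intros E3 d1 d2 H1 H2 E13 D1 D2.
auto_derive.
- repeat match goal with |- _ /\ _ => split end; trivial; eexists; eassumption.
- replace (Derive (fun x => e1 x) s) with (d1 * (2 * d)) by now symmetry; apply is_derive_unique.
  replace (Derive (fun x => e2 x) s) with (d2 * (2 * d)) by now symmetry; apply is_derive_unique.
  replace (Derive (fun x => q x) s) with (2 * d) by now symmetry; apply is_derive_unique.
  replace (Derive (fun x => g x) s) with ((/ 4 * m - 3 * (g s * m) + g s ^ 2) * d)
    by now symmetry; apply is_derive_unique.
  clear D1 D2 Dq Dg. revert HE2 H1 H2 E13 Epy Hq Hm.
  generalize (q s) (g s) (e1 s) (e2 s). intros x y E1 E2 HE2 H1 H2 E13 Epy Hq Hm.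
  assert (m = / x) by (apply Rmult_eq_reg_r with x; [|lra]; rewrite Rinv_l; lra).
  assert (d1 = ((1 - E1) / x - E2) / 2).
  { apply Rmult_eq_reg_l with x; [|lra].
    transitivity ((1 - x * E2 - E1) / 2); [lra | field; lra]. }
  assert (d2 = (E1 - 2 * E2) / (2 * x)).
  { apply Rmult_eq_reg_l with x; [|lra].
    transitivity ((E1 - 2 * E2) / 2); [lra | field; lra]. }
  apply Rminus_diag_uniq.
  transitivity (- d * m / (4 * E2) * (E1 ^ 2 - (2 * E2 - x * E2 ^ 2))).
  + clear Epy E13 H1 H2. subst m d1 d2. field. lra.
  + rewrite Epy. ring.
Qed.

(** One trajectory, at fixed [t]. The relation [m * q = 1] is propagated first, because the equation
    of the residue presupposes it. The range of [q] keeps [Etrig 2 q], a denominator there,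
    positive. *)
Lemma flow_frame3 (p k : R -> R3) (g m : R -> R) (s0 eta : R) :
  (forall s, Rabs (s - s0) < eta ->
    is_derive3 p s (lift3 (g s) (p s) (k s)) /\
    is_derive g s ((/ 4 * m s - 3 * (g s * m s) + g s ^ 2) * dot (p s) (k s)) /\
    is_derive m s (-2 * m s ^ 2 * dot (p s) (k s)) /\
    (exists k', is_derive3 k s k') /\
    0 < dot (p s) (p s) < (2 * PI) ^ 2) ->
  m s0 * dot (p s0) (p s0) = 1 ->
  kernel_coef_residue (dot (p s0) (p s0)) (g s0) = 0 ->
  forall s, Rabs (s - s0) < eta ->
    frame3 (p s) (0, 0, 0) (lift3 (g s) (p s) (k s)) = k s.
Proof.
intros H Hm0 Hg0.
set (q := fun s => dot (p s) (p s)). set (d := fun s => dot (p s) (k s)).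
assert (Hq : forall s, Rabs (s - s0) < eta -> is_derive q s (2 * d s)).
{ intros s Hs. destruct (H s Hs) as (Hp & _).
  replace (2 * d s) with
    (dot (lift3 (g s) (p s) (k s)) (p s) + dot (p s) (lift3 (g s) (p s) (k s))).
  - now apply is_derive_dot.
  - unfold d. rewrite <- (dot_lift3 (g s) (p s) (k s)). unfold dot. ring. }
assert (Hd : forall s, Rabs (s - s0) < eta -> ex_derive d s).
{ intros s Hs. destruct (H s Hs) as (Hp & _ & _ & [k' Hk] & _).
  eexists. apply is_derive_dot; eassumption. }
assert (Hmq : forall s, Rabs (s - s0) < eta -> m s * q s - 1 = 0).
{ apply (linear_ode_zero (fun s => m s * q s - 1) (fun s => -2 * m s * d s) s0).
  - intros s Hs. destruct (H s Hs) as (_ & _ & Hm & _). fold d in Hm.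
    change (dot (p s) (k s)) with (d s) in Hm.
    specialize (Hq s Hs). revert Hq Hm. generalize q d. clear. intros q d Hq Hm.
    auto_derive.
    + repeat match goal with |- _ /\ _ => split end; trivial; eexists; eassumption.
    + replace (Derive (fun x => m x) s) with (-2 * m s ^ 2 * d s)
        by now symmetry; apply is_derive_unique.
      replace (Derive (fun x => q x) s) with (2 * d s)
        by now symmetry; apply is_derive_unique.
      ring.
  - intros s Hs. destruct (H s Hs) as (_ & _ & Hm & _).
    specialize (Hd s Hs). apply @ex_derive_continuous.
    assert (Em : ex_derive m s) by (eexists; exact Hm).
    revert Hd Em. generalize d. clear. intros d Hd Em.
    auto_derive. now split.
  - unfold q. lra. }
assert (HE2 : forall s, Rabs (s - s0) < eta -> 0 < Etrig 2 (q s)).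
{ intros s Hs. apply Etrig_2_pos. now destruct (H s Hs) as (_ & _ & _ & _ & Hqs). }
assert (Hres : forall s, Rabs (s - s0) < eta -> kernel_coef_residue (q s) (g s) = 0).
{ apply (linear_ode_zero (fun s => kernel_coef_residue (q s) (g s))
    (fun s => d s * (g s - 2 * m s + m s * Etrig 1 (q s) / (2 * Etrig 2 (q s)))) s0);
    trivial.
  - intros s Hs. destruct (H s Hs) as (_ & Hg & _ & _ & Hqs).
    apply is_derive_kernel_coef_residue; auto.
    + apply Hqs.
    + generalize (Hmq s Hs). lra.
  - intros s Hs. destruct (H s Hs) as (_ & Hg & Hm & _).
    specialize (Hd s Hs). specialize (HE2 s Hs). specialize (Hq s Hs).
    apply @ex_derive_continuous.
    assert (Em : ex_derive m s) by (eexists; exact Hm).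
    assert (Eg : ex_derive g s) by (eexists; exact Hg).
    set (e1 := fun s : R => Etrig 1 (q s)). set (e2 := fun s : R => Etrig 2 (q s)).
    assert (HE : forall n, ex_derive (fun s => Etrig n (q s)) s).
    { intros n. apply (ex_derive_comp (Etrig n) q).
      - eexists. apply is_derive_Etrig.
      - now exists (2 * d s). }
    assert (He1 : ex_derive e1 s) by apply HE.
    assert (He2 : ex_derive e2 s) by apply HE.
    change (Etrig 2 (q s)) with (e2 s) in HE2.
    change (ex_derive (fun s => d s * (g s - 2 * m s + m s * e1 s / (2 * e2 s))) s).
    revert HE2 Hd Em Eg He1 He2. generalize e1 e2 d.
    clear. intros e1 e2 d HE2 Hd Em Eg He1 He2.
    auto_derive. repeat match goal with |- _ /\ _ => split end; trivial. lra. }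
intros s Hs. destruct (H s Hs) as (_ & _ & _ & _ & Hqs).
apply frame3_lift3; [apply Hqs | now apply HE2 | now apply Hres].
Qed.

Definition TSub (e1 e2 : term) : term := TAdd e1 (TMul (TCst (-1)) e2).

Definition dot_term (a b c k1 k2 k3 : term) : term :=
  TAdd (TAdd (TMul a k1) (TMul b k2)) (TMul c k3).

Definition lift_term (a b c k1 k2 k3 : term) : term :=
  TAdd (TAdd k1 (TMul (TCst (- / 2)) (TSub (TMul b k3) (TMul c k2))))
    (TMul (TVar 3) (TSub (TMul a (dot_term a b c k1 k2 k3))
                      (TMul (dot_term a b c a b c) k1))).

(* The unknowns are the coordinates of [p], then the coefficient [g] of [lift3]
   and [m = 1 / |p|^2]; the parameters are the coordinates of [kappa]. *)
Definition flow_term (i : nat) : term :=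
  let d := dot_term (TVar 0) (TVar 1) (TVar 2) (TPar 0) (TPar 1) (TPar 2) in
  match i with
  | 0 => lift_term (TVar 0) (TVar 1) (TVar 2) (TPar 0) (TPar 1) (TPar 2)
  | 1 => lift_term (TVar 1) (TVar 2) (TVar 0) (TPar 1) (TPar 2) (TPar 0)
  | 2 => lift_term (TVar 2) (TVar 0) (TVar 1) (TPar 2) (TPar 0) (TPar 1)
  | 3 => TMul (TAdd (TSub (TMul (TCst (/ 4)) (TVar 4))
                          (TMul (TCst 3) (TMul (TVar 3) (TVar 4))))
                    (TMul (TVar 3) (TVar 3))) d
  | 4 => TMul (TMul (TCst (-2)) (TMul (TVar 4) (TVar 4))) d
  | _ => TCst 0
  end.

(* The exponential of the skew matrix of [(PI, 0, 0)] is diagonal, and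
   [(p/2) cot (p/2)] vanishes at [p = PI], whence the value of [g]. *)
Definition flow_init (i : nat) : R :=
  match i with
  | 0 => PI
  | 3 | 4 => / PI ^ 2
  | _ => 0
  end.

(** From index [5] on all terms are [TCst 0], so a maximum of six values suffices. *)
Lemma flow_term_bound (A B : R) : exists K, forall i, tbound (flow_term i) A B <= K.
Proof.
set (b := fun i => tbound (flow_term i) A B).
exists (Rmax (b 0%nat) (Rmax (b 1%nat) (Rmax (b 2%nat)
  (Rmax (b 3%nat) (Rmax (b 4%nat) (b 5%nat)))))).
intros i. change (tbound (flow_term i) A B) with (b i).
destruct i as [|[|[|[|[|i]]]]].
- apply Rmax_l.
- eapply Rle_trans, Rmax_r. apply Rmax_l.
- do 2 (eapply Rle_trans, Rmax_r). apply Rmax_l.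
- do 3 (eapply Rle_trans, Rmax_r). apply Rmax_l.
- do 4 (eapply Rle_trans, Rmax_r). apply Rmax_l.
- do 4 (eapply Rle_trans, Rmax_r). exact (Rmax_r (b 4%nat) (b 5%nat)).
Qed.

Lemma flow_init_bound (i : nat) : Rabs (flow_init i) <= PI.
Proof.
assert (H3 : 3 < PI) by (generalize PI2_3_2; unfold PI2; lra).
assert (H : Rabs (/ PI ^ 2) <= PI).
{ rewrite Rabs_right by (apply Rle_ge, Rlt_le, Rinv_0_lt_compat, pow_lt; lra).
  apply Rle_trans with 1; [|lra].
  rewrite <- Rinv_1. apply Rinv_le_contravar; [lra|].
  apply pow_R1_Rle. lra. }
destruct i as [|[|[|[|[|i]]]]]; simpl flow_init; trivial; rewrite ?Rabs_R0; try lra.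
rewrite Rabs_right; lra.
Qed.

Lemma Etrig_1_PI : Etrig 1 (PI ^ 2) = 0.
Proof.
rewrite <- coef_sin_Etrig. unfold coef_sin. generalize PI_RGT_0. intros HPI.
destruct (Req_EM_T PI 0) as [E|_]; [lra|]. rewrite sin_PI. field. lra.
Qed.

Lemma Rabs_minus_le_derive (h h' : R -> R) (s0 eta L s : R) :
  (forall z, Rabs (z - s0) < eta -> is_derive h z (h' z) /\ Rabs (h' z) <= L) ->
  Rabs (s - s0) < eta -> Rabs (h s - h s0) <= L * Rabs (s - s0).
Proof.
intros Hh Hs.
assert (Hin := fun z => Rabs_between s0 eta s z Hs).
destruct (MVT_gen h s0 s h') as [z [Hz E]].
- intros z Hz. apply Hh, Hin. lra.
- intros z Hz. apply continuity_pt_filterlim, (@ex_derive_continuous R_AbsRing R_NormedModule).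
  eexists. now apply Hh, Hin.
- rewrite E, Rabs_mult. apply Rmult_le_compat_r; [apply Rabs_pos|].
  now apply Hh, Hin.
Qed.

Lemma kappa_of_exists (kappa : R -> R -> R3) (s0 t0 : R) :
  analytic2_at kappa s0 t0 ->
  exists (eta : R) (p : R -> R -> R3), 0 < eta /\
    (forall t, p s0 t = (PI, 0, 0)) /\
    forall s t, Rabs (s - s0) < eta -> Rabs (t - t0) < eta ->
      analytic2_at p s t /\ kappa s t = kappa_of p s t.
Proof.
intros Hk.
destruct (analytic2_at_rep2 _ _ _ vec_x (or_introl eq_refl) Hk) as (M1 & r1 & a1 & Q1).
destruct (analytic2_at_rep2 _ _ _ vec_y (or_intror (or_introl eq_refl)) Hk)
  as (M2 & r2 & a2 & Q2).
destruct (analytic2_at_rep2 _ _ _ vec_z (or_intror (or_intror eq_refl)) Hk)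
  as (M3 & r3 & a3 & Q3).
set (M := Rmax M1 (Rmax M2 M3)). set (r := Rmax r1 (Rmax r2 r3)).
assert (HM1 : M1 <= M) by apply Rmax_l.
assert (HM2 : M2 <= M) by (eapply Rle_trans, Rmax_r; apply Rmax_l).
assert (HM3 : M3 <= M) by (eapply Rle_trans, Rmax_r; apply Rmax_r).
assert (Hr1 : r1 <= r) by apply Rmax_l.
assert (Hr2 : r2 <= r) by (eapply Rle_trans, Rmax_r; apply Rmax_l).
assert (Hr3 : r3 <= r) by (eapply Rle_trans, Rmax_r; apply Rmax_r).
apply (rep2_weaken _ _ _ M1 M r1 r _ HM1 Hr1) in Q1.
apply (rep2_weaken _ _ _ M2 M r2 r _ HM2 Hr2) in Q2.
apply (rep2_weaken _ _ _ M3 M r3 r _ HM3 Hr3) in Q3.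
clearbody M r. clear HM1 HM2 HM3 Hr1 Hr2 Hr3.
assert (Hr : 0 < r) by apply Q1.
assert (HM : 0 <= M) by (eapply geo2_nonneg; apply Q1).
set (k := fun i => match i with
  | 0%nat => a1 | 1%nat => a2 | 2%nat => a3 | _ => const2 0 end).
assert (Hkg : forall i, geo2 M r (k i)).
{ intros [|[|[|i]]]; [apply Q1 | apply Q2 | apply Q3|].
  apply geo2_weaken with (Rabs 0) r; try lra.
  - rewrite Rabs_R0; lra.
  - now apply geo2_const2. }
assert (HPI : 3 < PI) by (generalize PI2_3_2; unfold PI2; lra).
destruct (polynomial_ode flow_term k flow_init PI M r ltac:(lra) Hr
  flow_init_bound Hkg (flow_term_bound PI M)) as (r' & Hrr & Hu & Hu0 & Hode).
set (u := ode_coef flow_term k flow_init) in *.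
assert (Hr' : 0 < r') by lra.
(* The coordinates of [p] have derivatives at most [4 * PI * r'], so over this distance they move by
   at most [/ 10] from [(PI, 0, 0)], which keeps [|p|] strictly between [0] and [2 * PI]. *)
set (eta := / (40 * PI * r')).
assert (Heta : eta * (40 * PI * r') = 1) by (apply Rinv_l; nra).
assert (Heta0 : 0 < eta) by (apply Rinv_0_lt_compat; nra).
assert (Hsm : forall z, Rabs z < eta -> Rabs z * (8 * r') < 1).
{ intros z Hz. assert (Hz0 := Rabs_pos z).
  apply Rle_lt_trans with (Rabs z * (40 * PI * r')).
  - apply Rmult_le_compat_l; nra.
  - rewrite <- Heta. apply Rmult_lt_compat_r; nra. }
set (y := fun i s t => PS2 (u i) (s - s0) (t - t0)).
set (p := fun s t => (y 0%nat s t, y 1%nat s t, y 2%nat s t) : R3).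
assert (Hrep : forall i, rep2 (y i) s0 t0 PI r' (u i)) by (intros i; repeat split; auto).
assert (Hy0 : forall i t, y i s0 t = flow_init i).
{ intros i t. unfold y. now rewrite Rminus_eq_0, Hu0. }
exists eta, p. split; [trivial|]. split.
{ intros t. unfold p. now rewrite !Hy0. }
intros s t Hs Ht. split.
{ assert (Hs' : Rabs (s - s0) * (2 * r') <= / 4) by (specialize (Hsm _ Hs); lra).
  assert (Ht' : Rabs (t - t0) * (2 * r') <= / 4) by (specialize (Hsm _ Ht); lra).
  exact (rep2_analytic2_at p s t _ _ _ _ _
    (rep2_recenter _ _ _ _ _ _ s t (Hrep 0%nat) Hs' Ht')
    (rep2_recenter _ _ _ _ _ _ s t (Hrep 1%nat) Hs' Ht')
    (rep2_recenter _ _ _ _ _ _ s t (Hrep 2%nat) Hs' Ht')). }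
assert (Hder : forall i z, Rabs (z - s0) < eta -> is_derive (fun z => y i z t) z
   (teval (flow_term i) (fun i => y i z t) (fun i => PS2 (k i) (z - s0) (t - t0)))).
{ intros i z Hz.
  replace (teval _ _ _) with (scal 1 (teval (flow_term i) (fun i => y i z t)
    (fun i => PS2 (k i) (z - s0) (t - t0)))) by apply Rmult_1_l.
  apply (is_derive_comp (fun x => PS2 (u i) x (t - t0)) (fun z => z - s0)).
  - apply Hode; [specialize (Hsm _ Hz) | specialize (Hsm _ Ht)]; lra.
  - auto_derive; trivial; ring. }
assert (Hbox : forall z, Rabs z < eta -> Rabs z * r <= / 2).
{ intros z Hz. specialize (Hsm z Hz). assert (Hz0 := Rabs_pos z). nra. }
assert (Hkap : forall z, Rabs (z - s0) < eta -> kappa z t =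
  (PS2 (k 0%nat) (z - s0) (t - t0), PS2 (k 1%nat) (z - s0) (t - t0),
   PS2 (k 2%nat) (z - s0) (t - t0))).
{ intros z Hz. destruct Q1 as (_ & _ & Q1), Q2 as (_ & _ & Q2), Q3 as (_ & _ & Q3).
  apply Hbox in Hz, Ht.
  apply injective_projections; [apply injective_projections|]; simpl.
  - now apply Q1.
  - now apply Q2.
  - now apply Q3. }
assert (Hlip : forall i z, Rabs (z - s0) < eta -> Rabs (y i z t - flow_init i) <= / 10).
{ intros i z Hz. rewrite <- (Hy0 i t).
  apply Rle_trans with (4 * (PI * r') * Rabs (z - s0)).
  - apply (Rabs_minus_le_derive (fun z => y i z t)
      (fun z => PS2 (dx (u i)) (z - s0) (t - t0)) s0 eta); trivial.
    intros w Hw. split.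
    + destruct (rep2_dx _ _ _ _ _ _ (Hrep i)) as [Hd _].
      apply Hd; [specialize (Hsm _ Hw) | specialize (Hsm _ Ht)]; lra.
    + apply PS2_geo2 with (2 * r'); [lra | now apply geo2_dx| |];
      [specialize (Hsm _ Hw) | specialize (Hsm _ Ht)]; lra.
  - assert (Hz' : Rabs (z - s0) * (40 * PI * r') <= eta * (40 * PI * r'))
      by (apply Rmult_le_compat_r; nra).
    rewrite Heta in Hz'. lra. }
assert (Hflow : forall z, Rabs (z - s0) < eta ->
  is_derive3 (fun z => p z t) z (lift3 (y 3%nat z t) (p z t) (kappa z t))).
{ intros z Hz. rewrite (Hkap z Hz). apply is_derive3_coordinates.
  - refine (eq_ind _ _ (Hder 0%nat z Hz) _ _).
    unfold lift3, lift_x, p, vec_x, vec_y, vec_z. simpl. ring.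
  - refine (eq_ind _ _ (Hder 1%nat z Hz) _ _).
    unfold lift3, lift_x, p, vec_x, vec_y, vec_z. simpl. ring.
  - refine (eq_ind _ _ (Hder 2%nat z Hz) _ _).
    unfold lift3, lift_x, p, vec_x, vec_y, vec_z. simpl. ring. }
rewrite kappa_of_frame.
replace (d_s p s t) with (lift3 (y 3%nat s t) (p s t) (kappa s t))
  by (symmetry; now apply is_derive3_unique, Hflow).
symmetry.
apply (flow_frame3 (fun z => p z t) (fun z => kappa z t) (fun z => y 3%nat z t)
  (fun z => y 4%nat z t) s0 eta); trivial.
- intros z Hz. split; [now apply Hflow|]. split; [|split; [|split]].
  + refine (eq_ind _ _ (Hder 3%nat z Hz) _ _).
    rewrite (Hkap z Hz). unfold dot, p, vec_x, vec_y, vec_z. simpl. ring.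
  + refine (eq_ind _ _ (Hder 4%nat z Hz) _ _).
    rewrite (Hkap z Hz). unfold dot, p, vec_x, vec_y, vec_z. simpl. ring.
  + assert (Hs4 : Rabs (z - s0) * (4 * r') <= / 2) by (specialize (Hsm _ Hz); lra).
    assert (Ht4 : Rabs (t - t0) * (4 * r') <= / 2) by (specialize (Hsm _ Ht); lra).
    assert (W := fun f a => rep2_weaken f s0 t0 M M r r' a (Rle_refl M) Hrr).
    eexists (_, _, _). apply is_derive3_coordinates.
    * now apply (rep2_dx _ _ _ _ _ _ (W _ _ Q1)).
    * now apply (rep2_dx _ _ _ _ _ _ (W _ _ Q2)).
    * now apply (rep2_dx _ _ _ _ _ _ (W _ _ Q3)).
  + assert (L0 := proj1 (Rabs_le_between _ _) (Hlip 0%nat z Hz)).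
    assert (L1 := proj1 (Rabs_le_between _ _) (Hlip 1%nat z Hz)).
    assert (L2 := proj1 (Rabs_le_between _ _) (Hlip 2%nat z Hz)).
    unfold dot, p, vec_x, vec_y, vec_z. simpl in L0, L1, L2 |- *.
    revert L0 L1 L2.
    generalize (y 0%nat z t) (y 1%nat z t) (y 2%nat z t).
    intros a b c La Lb Lc. split; nra.
- rewrite !Hy0. unfold dot, p, vec_x, vec_y, vec_z. simpl.
  rewrite !Hy0. simpl. field. lra.
- rewrite !Hy0. unfold p. rewrite !Hy0. simpl flow_init.
  replace (dot (PI, 0, 0) (PI, 0, 0)) with (PI ^ 2)
    by (unfold dot, vec_x, vec_y, vec_z; simpl; ring).
  unfold kernel_coef_residue.
  rewrite Etrig_1_PI. field. lra.
Qed.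

(** * Recovering [f] and propagating [omega] *)

Lemma frame3_half_turn (F : R3) :
  frame3 (PI, 0, 0) F (0, 0, 0) = (vec_x F, - vec_y F, - vec_z F).
Proof.
assert (HPI := PI_RGT_0).
assert (E : dot (PI, 0, 0) (PI, 0, 0) = PI ^ 2)
  by (unfold dot, vec_x, vec_y, vec_z; simpl; ring).
unfold frame3, frame. rewrite E, Etrig_1_PI.
replace (Etrig 2 (PI ^ 2)) with (2 / PI ^ 2).
2: { rewrite <- coef_cos_Etrig. unfold coef_cos.
     destruct (Req_EM_T PI 0) as [Z|_]; [lra|]. rewrite cos_PI. f_equal. ring. }
destruct F as [[f1 f2] f3].
repeat apply f_equal2; unfold frame_x, vec_x, vec_y, vec_z; simpl; field; lra.
Qed.

(** The exponential of the skew matrix of [(PI, 0, 0)]. Being an involution, it also solves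
    [omega = omega_of p f] for [f] at [s = s0]. *)
Definition half_turn (v : R3) : R3 := (vec_x v, - vec_y v, - vec_z v).

(** On the line [s = s0] the powers of [s - s0] vanish except the zeroth, so the row [A 0] alone
    remains. *)
Lemma analytic1_at_half_turn (w : R -> R -> R3) (s0 t0 : R) :
  analytic2_at w s0 t0 -> analytic1_at (fun t => half_turn (w s0 t)) t0.
Proof.
intros (A & r & Hr & HA).
exists (fun n => half_turn (A 0%nat n)), r. split; [trivial|].
intros t Ht.
assert (H0 : Rabs (s0 - s0) < r) by (rewrite Rminus_eq_0, Rabs_R0; trivial).
destruct (HA s0 t H0 Ht) as [_ HS]. clear HA. rewrite Rminus_eq_0 in HS.
assert (Hc : forall c, coordinate c ->
  is_series (fun n => (t - t0) ^ n * c (A 0%nat n)) (c (w s0 t))).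
{ intros c Hc.
  refine (is_series_ext _ _ _ _ (coordinate_is_series c _ _ Hc HS)).
  intros n. rewrite coordinate_sum_n by trivial.
  destruct n as [|n].
  - rewrite sum_O, coordinate_scal by trivial. simpl. ring.
  - unfold sum_n. rewrite sum_Sn_m by lia.
    rewrite (sum_n_m_ext_loc _ (fun _ => zero)).
    + rewrite sum_n_m_const_zero, plus_zero_r, coordinate_scal by trivial.
      rewrite Nat.sub_0_r. simpl. ring.
    + intros k Hk. rewrite coordinate_scal by trivial.
      rewrite pow_i by lia. rewrite Rmult_0_l. apply Rmult_0_l. }
assert (Hpow : forall n, pow_n (t - t0) n = (t - t0) ^ n).
{ induction n as [|n IH]; [reflexivity|]. simpl. now rewrite IH. }
apply is_series_coordinates. intros c Hc'.
apply is_series_ext with (fun n => (t - t0) ^ n * c (half_turn (A 0%nat n))).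
{ intros n. rewrite <- Hpow. symmetry. exact (coordinate_scal c _ _ Hc'). }
assert (Hopp : forall c, coordinate c ->
  is_series (fun n => (t - t0) ^ n * - c (A 0%nat n)) (- c (w s0 t))).
{ intros c1 Hc1. refine (is_series_ext _ _ _ _ (is_series_opp _ _ (Hc c1 Hc1))).
  intros n. unfold opp; simpl. ring. }
destruct Hc' as [-> | [-> | ->]].
- apply (Hc vec_x). now left.
- apply (Hopp vec_y). now right; left.
- apply (Hopp vec_z). now right; right.
Qed.

Lemma is_derive3_minus (f g : R -> R3) (x : R) (l m : R3) :
  is_derive3 f x l -> is_derive3 g x m ->
  is_derive3 (fun u => minus (f u) (g u)) x (minus l m).
Proof.
intros Hf Hg.
apply is_derive3_coordinates.
- exact (is_derive_minus _ _ _ _ _ (is_derive3_x _ _ _ Hf) (is_derive3_x _ _ _ Hg)).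
- exact (is_derive_minus _ _ _ _ _ (is_derive3_y _ _ _ Hf) (is_derive3_y _ _ _ Hg)).
- exact (is_derive_minus _ _ _ _ _ (is_derive3_z _ _ _ Hf) (is_derive3_z _ _ _ Hg)).
Qed.

Lemma is_derive3_ext_loc (f g : R -> R3) (x : R) (l : R3) :
  locally x (fun u => f u = g u) -> is_derive3 f x l -> is_derive3 g x l.
Proof.
intros Hfg Hf c Hc. apply is_derive_ext_loc with (2 := Hf c Hc).
revert Hfg. apply filter_imp. now intros u ->.
Qed.

Lemma dot_self_eq_0 (v : R3) : dot v v = 0 -> v = zero.
Proof.
destruct v as [[a b] c]. unfold dot, vec_x, vec_y, vec_z. simpl. intros H.
assert (a = 0) by nra. assert (b = 0) by nra. assert (c = 0) by nra.
now subst.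
Qed.

(* Both fields solve [W' = d_t kappa - W x kappa], so their difference [V]
   satisfies [V' = - V x kappa] and [|V|] is constant. *)
Lemma transport_unique (w1 w2 k k' : R -> R3) (s0 eta : R) :
  (forall s, Rabs (s - s0) < eta -> exists l1 l2,
    is_derive3 w1 s l1 /\ is_derive3 w2 s l2 /\
    plus (minus l1 (k' s)) (cross (w1 s) (k s)) = zero /\
    plus (minus l2 (k' s)) (cross (w2 s) (k s)) = zero) ->
  w1 s0 = w2 s0 -> forall s, Rabs (s - s0) < eta -> w1 s = w2 s.
Proof.
intros H H0 s Hs.
set (V := fun s => minus (w1 s) (w2 s)).
assert (HV : dot (V s) (V s) = dot (V s0) (V s0)).
{ apply (constant_on_interval (fun s => dot (V s) (V s)) s0 eta); trivial.
  intros z Hz. destruct (H z Hz) as (l1 & l2 & H1 & H2 & E1 & E2).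
  assert (DV : is_derive3 V z (minus l1 l2)) by now apply is_derive3_minus.
  assert (D := is_derive_dot V V z _ _ DV DV).
  replace 0 with (dot (minus l1 l2) (V z) + dot (V z) (minus l1 l2)); trivial.
  unfold V. revert E1 E2. generalize (w1 z) (w2 z) (k z) (k' z).
  clear. intros [[a1 b1] c1] [[a2 b2] c2] [[k1 k2] k3] [[m1 m2] m3] E1 E2.
  destruct l1 as [[x1 y1] z1], l2 as [[x2 y2] z2].
  assert (X1 : x1 - m1 + (b1 * k3 - c1 * k2) = 0) by exact (f_equal vec_x E1).
  assert (Y1 : y1 - m2 + (c1 * k1 - a1 * k3) = 0) by exact (f_equal vec_y E1).
  assert (Z1 : z1 - m3 + (a1 * k2 - b1 * k1) = 0) by exact (f_equal vec_z E1).
  assert (X2 : x2 - m1 + (b2 * k3 - c2 * k2) = 0) by exact (f_equal vec_x E2).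
  assert (Y2 : y2 - m2 + (c2 * k1 - a2 * k3) = 0) by exact (f_equal vec_y E2).
  assert (Z2 : z2 - m3 + (a2 * k2 - b2 * k1) = 0) by exact (f_equal vec_z E2).
  change ((x1 - x2) * (a1 - a2) + (y1 - y2) * (b1 - b2) + (z1 - z2) * (c1 - c2)
    + ((a1 - a2) * (x1 - x2) + (b1 - b2) * (y1 - y2) + (c1 - c2) * (z1 - z2)) = 0).
  replace x1 with (m1 - (b1 * k3 - c1 * k2)) by lra.
  replace x2 with (m1 - (b2 * k3 - c2 * k2)) by lra.
  replace y1 with (m2 - (c1 * k1 - a1 * k3)) by lra.
  replace y2 with (m2 - (c2 * k1 - a2 * k3)) by lra.
  replace z1 with (m3 - (a1 * k2 - b1 * k1)) by lra.
  replace z2 with (m3 - (a2 * k2 - b2 * k1)) by lra.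
  ring. }
assert (HV0 : dot (V s0) (V s0) = 0).
{ unfold V. rewrite H0, minus_eq_zero. change (0 * 0 + 0 * 0 + 0 * 0 = 0). ring. }
rewrite HV0 in HV.
apply dot_self_eq_0 in HV. revert HV. unfold V. generalize (w1 s) (w2 s).
intros [[a1 b1] c1] [[a2 b2] c2] E.
assert (a1 - a2 = 0) by exact (f_equal vec_x E).
assert (b1 - b2 = 0) by exact (f_equal vec_y E).
assert (c1 - c2 = 0) by exact (f_equal vec_z E).
repeat apply f_equal2; lra.
Qed.

Lemma open_box (s0 t0 eta : R) :
  open (fun z : R * R => Rabs (fst z - s0) < eta /\ Rabs (snd z - t0) < eta).
Proof.
apply @open_and.
- intros [s t] Hs. simpl in Hs.
  destruct (Rabs_lt_locally _ _ _ Hs) as [e He].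
  exists e. intros [s' t'] [B _]. now apply He.
- intros [s t] Ht. simpl in Ht.
  destruct (Rabs_lt_locally _ _ _ Ht) as [e He].
  exists e. intros [s' t'] [_ B]. now apply He.
Qed.

Lemma omega_of_unique (eta s0 t0 : R) (omega kappa p : R -> R -> R3) :
  let B := fun z : R * R => Rabs (fst z - s0) < eta /\ Rabs (snd z - t0) < eta in
  analytic2_on B omega -> analytic2_on B p -> is_solution B omega kappa ->
  (forall t, p s0 t = (PI, 0, 0)) ->
  (forall s t, B (s, t) -> kappa s t = kappa_of p s t) ->
  forall s t, B (s, t) -> omega s t = omega_of p (fun t => half_turn (omega s0 t)) s t.
Proof.
intros B Hw Hp Hsol Hp0 Hk s t [Hs Ht]. simpl in Hs, Ht.
set (f := fun t => half_turn (omega s0 t)).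
apply (transport_unique (fun z => omega z t) (fun z => omega_of p f z t)
  (fun z => kappa z t) (fun z => d_t kappa z t) s0 eta); trivial.
- intros z Hz.
  assert (Hzt : B (z, t)) by now split.
  destruct (analytic2_at_twice_derivable _ _ _ (Hw z t Hzt)) as (S & _ & _ & HS & _).
  destruct (solution_of_twice_derivable p f z t) as (O & K & HO & HK & HOK).
  { now apply analytic2_at_twice_derivable, Hp. }
  exists S, O. split; [trivial|]. split; [trivial|].
  destruct (Hsol z t Hzt) as (_ & _ & E).
  replace (d_s omega z t) with S in E by (symmetry; now apply is_derive3_unique).
  split; [exact E|].
  (* The [t]-derivatives can be identified because [kappa] and [kappa_of p] agree on a whole
     neighbourhood of [t]. *)
  assert (HK' : is_derive3 (fun t' => kappa z t') t K).
  { apply is_derive3_ext_loc with (2 := HK).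
    generalize (Rabs_lt_locally _ _ _ Ht). apply filter_imp.
    intros t' Ht'. symmetry. apply Hk. now split. }
  replace (d_t kappa z t) with K by (symmetry; now apply is_derive3_unique).
  now rewrite Hk.
- rewrite omega_of_frame, Hp0.
  (* [p s0] is constant in [t], so at [s = s0] only the rotated [f] is left. *)
  replace (d_t p s0 t) with ((0, 0, 0) : R3).
  + rewrite frame3_half_turn. unfold f, half_turn, vec_x, vec_y, vec_z.
    destruct (omega s0 t) as [[a b] c]. simpl. now rewrite !Ropp_involutive.
  + symmetry. apply is_derive3_unique.
    apply is_derive3_ext_loc with (fun _ => (PI, 0, 0)).
    * apply filter_forall. intros u. now rewrite Hp0.
    * apply is_derive3_coordinates; apply @is_derive_const.
Qed.

Theorem proposition1 :
  (forall (D : R * R -> Prop) (I : R -> Prop) (p : R -> R -> R3) (f : R -> R3),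
      open D -> open I ->
      (forall s t : R, D (s, t) -> I t) ->
      analytic2_on D p -> analytic1_on I f ->
      is_solution D (omega_of p f) (kappa_of p))
  /\
  (forall (s0 t0 : R) (D : R * R -> Prop) (omega kappa : R -> R -> R3),
      open D -> D (s0, t0) ->
      analytic2_on D omega -> analytic2_on D kappa ->
      is_solution D omega kappa ->
      exists (E : R * R -> Prop) (I : R -> Prop) (U : R * R -> Prop)
             (p : R -> R -> R3) (f : R -> R3),
        open E /\ E (s0, t0) /\ analytic2_on E p /\
        open I /\ I t0 /\ analytic1_on I f /\
        open U /\ U (s0, t0) /\
        forall s t : R, U (s, t) ->
          D (s, t) /\ E (s, t) /\ I t /\
          omega s t = omega_of p f s t /\
          kappa s t = kappa_of p s t).
Proof.
split.
- intros D I p f _ _ _ Hp _. now apply omega_kappa_solution.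
- intros s0 t0 D omega kappa HD HD0 Hw Hk Hsol.
  destruct (HD _ HD0) as [delta Hdelta].
  destruct (kappa_of_exists kappa s0 t0 (Hk _ _ HD0)) as (eta0 & p & Heta0 & Hp0 & Hp).
  (* Balls of the product are boxes: the box of half-side [eta] lies in [D] and in the domain where
     [p] is controlled. *)
  set (eta := Rmin delta eta0).
  assert (Heta : 0 < eta) by (apply Rmin_pos; [apply cond_pos | trivial]).
  set (B := fun z : R * R => Rabs (fst z - s0) < eta /\ Rabs (snd z - t0) < eta).
  assert (HBD : forall s t, B (s, t) -> D (s, t)).
  { intros s t [Hs Ht]. apply Hdelta.
    split; [apply Rlt_le_trans with (1 := Hs) | apply Rlt_le_trans with (1 := Ht)];
    apply Rmin_l. }
  assert (HBp : forall s t, B (s, t) ->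
    analytic2_at p s t /\ kappa s t = kappa_of p s t).
  { intros s t [Hs Ht]. apply Hp.
    - apply Rlt_le_trans with (1 := Hs). apply Rmin_r.
    - apply Rlt_le_trans with (1 := Ht). apply Rmin_r. }
  assert (HB0 : forall z, Rabs (z - z) < eta)
    by (intros z; now rewrite Rminus_eq_0, Rabs_R0).
  (* [f] is read off from [omega] on the line [s = s0], so the slice of [D] over that line is a
     natural open domain for it. *)
  exists B, (fun t => D (s0, t)), B, p, (fun t => half_turn (omega s0 t)).
  split; [apply open_box|]. split; [split; apply HB0|].
  split; [intros s t Hst; now apply HBp|].
  split.
  { intros t Ht. destruct (HD _ Ht) as [e He]. exists e. intros t' Ht'.
    apply He. split; [apply ball_center | exact Ht']. }
  split; [exact HD0|].
  split; [intros t Ht; now apply analytic1_at_half_turn, Hw|].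
  split; [apply open_box|]. split; [split; apply HB0|].
  intros s t Hst. split; [now apply HBD|]. split; [trivial|].
  split; [apply HBD; split; [apply HB0 | apply Hst]|].
  split; [|now apply HBp].
  apply (omega_of_unique eta s0 t0 omega kappa p); trivial.
  + intros x y Hxy. now apply Hw, HBD.
  + intros x y Hxy. now apply HBp.
  + intros x y Hxy. now apply Hsol, HBD.
  + intros x y Hxy. now apply HBp.
Qed.
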